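(* Let $K$ be an algebraically closed field. For every integer $m \geq 1$, the $K$-algebra $A(m,1)$ is geometrically irreducible.
   Context: $K$ is an algebraically closed field; varieties carry the Zariski topology. A finite-dimensional $K$-algebra $A$ is called geometrically irreducible if, for each dimension $d \geq 0$, every connected component of the affine variety $\mathrm{mod}(A,d)$ of $d$-dimensional $A$-module structures (i.e. of $K$-algebra homomorphisms from $A$ to the algebra of $(d \times d)$-matrices over $K$) is irreducible. For $m \geq 1$ let $\Lambda := K[X]/(X^m)$. Then $$A(m,1) := \begin{bmatrix} \Lambda & \Gamma \\ 0 & \Lambda \end{bmatrix},$$ where $\Gamma := (\Lambda \otimes_K \Lambda)/(1 \otimes X + X \otimes 1)$, viewed as a $\Lambda$-bimodule. (The algebra $A(m,1)$ is isomorphic to the upper triangular matrix algebra $\begin{bmatrix} \Lambda & \Lambda \\ 0 & \Lambda \end{bmatrix}$.) *)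

(* Defs.v *)
From HB Require Import structures.
From mathcomp Require Import all_boot all_order all_algebra all_field.
From mathcomp Require Import boolp classical_sets functions topology.
From mathcomp Require Import -(notations) mpoly.

Set Implicit Arguments.
Unset Strict Implicit.
Unset Printing Implicit Defensive.

Import GRing.Theory.
Local Open Scope ring_scope.
Local Open Scope classical_set_scope.

Section ZeroLocus.
Variables (K : fieldType) (V : vectType K).

Definition coords (v : V) : 'I_(\dim {:V}) -> K :=
  fun i => coord (vbasis {:V}) i v.

(* Changing the basis is a linear substitution in the polynomials, so the
   topology below does not depend on the choice of basis. *)
Definition zero_locus (S : set (mpoly (\dim {:V}) K)) : set V :=
  [set v | forall p, S p -> meval (coords v) p = 0].

Definition zariski_open (U : set V) : Prop := exists S, U = ~` zero_locus S.

Lemma zariski_openT : zariski_open setT.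
Proof.
exists setT; rewrite eqEsubset; split=> // v _ /(_ 1 I)/eqP.
by rewrite meval1 oner_eq0.
Qed.

Lemma zariski_openI : setI_closed zariski_open.
Proof.
move=> _ _ [S ->] [S' ->].
exists [set p * q | p in S & q in S']; rewrite -setCU; congr (~` _).
rewrite eqEsubset; split=> v.
  move=> v0 _ [p Sp [q S'q <-]]; rewrite mevalM.
  by case: v0 => v0; [rewrite (v0 _ Sp) mul0r | rewrite (v0 _ S'q) mulr0].
move=> v0; have [|/existsNP[p /not_implyP[Sp p0]]] := pselect (zero_locus S v).
  by left.
right=> q S'q; apply/eqP; have /eqP : meval (coords v) (p * q) = 0.
  by apply: v0; exists p => //; exists q.
by rewrite mevalM mulf_eq0 => /orP[/eqP|].
Qed.

Lemma zariski_open_bigU (I : Type) (f : I -> set V) :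
  (forall i, zariski_open (f i)) -> zariski_open (\bigcup_i f i).
Proof.
move=> /choice[S fS]; exists (\bigcup_i S i).
rewrite eqEsubset; split=> v.
  by move=> [i _]; rewrite fS => fv v0; apply: fv => p Sp; apply: v0; exists i.
move=> /existsNP[p /not_implyP[[i _ Sp] p0]].
by exists i => //; rewrite fS => /(_ _ Sp).
Qed.

End ZeroLocus.

Definition zariski (K : fieldType) (V : vectType K) : Type := V.
HB.instance Definition _ (K : fieldType) (V : vectType K) :=
  Choice.on (zariski V).
HB.instance Definition _ (K : fieldType) (V : vectType K) :=
  isOpenTopological.Build (zariski V) (@zariski_openT K V)
    (@zariski_openI K V) (@zariski_open_bigU K V).

Definition irreducible_set (T : topologicalType) (A : set T) : Prop :=
  A !=set0 /\ forall F G : set T, closed F -> closed G ->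
    A `<=` F `|` G -> A `<=` F \/ A `<=` G.

(* A closed subset of the affine space Hom_K(A, 'M_d). *)
Definition module_variety (K : fieldType) (A : falgType K) (d : nat) :
    set (zariski 'Hom(A, 'M[K]_d)) :=
  [set f : 'Hom(A, 'M[K]_d) |
    f 1 = 1%:M /\ forall a b : A, f (a * b) = f a *m f b].

Arguments module_variety {K} A d _ : rename.

Definition geometrically_irreducible (K : fieldType) (A : falgType K) : Prop :=
  forall (d : nat) (f : zariski 'Hom(A, 'M[K]_d)),
    module_variety A d f ->
    irreducible_set (connected_component (module_variety A d) f).

(* U ⊗ V with basis e_i ⊗ f_j, for e and f the fixed bases of U and V;
   [tensor_universal] is its universal property. *)
Section Tensor.
Variables (K : fieldType) (U V : vectType K).

Definition tensor := 'M[K]_(\dim {:U}, \dim {:V}).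
HB.instance Definition _ := Vector.on tensor.

Definition tens (u : U) (v : V) : tensor :=
  \matrix_(i, j) (coord (vbasis {:U}) i u * coord (vbasis {:V}) j v).

Definition tens_lift (W : vectType K) (b : U -> V -> W) (t : tensor) : W :=
  \sum_i \sum_j t i j *: b (vbasis {:U})`_i (vbasis {:V})`_j.

Fact tens_lift_is_linear (W : vectType K) (b : U -> V -> W) :
  linear (tens_lift b).
Proof.
move=> a s t; rewrite /tens_lift scaler_sumr -big_split /=.
apply: eq_bigr => i _; rewrite scaler_sumr -big_split /=.
by apply: eq_bigr => j _; rewrite !mxE scalerDl scalerA.
Qed.
HB.instance Definition _ (W : vectType K) (b : U -> V -> W) :=
  GRing.isLinear.Build K tensor W _ (tens_lift b) (tens_lift_is_linear b).

Lemma tens_linearl v : linear (tens^~ v).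
Proof.
by move=> a u u'; apply/matrixP=> i j; rewrite !mxE linearP mulrDl mulrA.
Qed.

Lemma tens_linearr u : linear (tens u).
Proof.
by move=> a v v'; apply/matrixP=> i j; rewrite !mxE linearP mulrDr mulrCA.
Qed.

Lemma tens_liftE (W : vectType K) (b : U -> V -> W) u v :
  (forall y, linear (b^~ y)) -> (forall x, linear (b x)) ->
  tens_lift b (tens u v) = b u v.
Proof.
move=> bl br; have blD := fun y => GRing.isLinear.Build K U W _ _ (bl y).
pose bL y : {linear U -> W} := HB.pack (b^~ y) (blD y).
have brD := fun x => GRing.isLinear.Build K V W _ _ (br x).
pose bR x : {linear V -> W} := HB.pack (b x) (brD x).
rewrite -[RHS]/(bL v u) [in RHS](coord_vbasis (memvf u)) linear_sum.
apply: eq_bigr => i _; rewrite linearZ /= -[b _ v]/(bR _ v).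
rewrite [X in bR _ X](coord_vbasis (memvf v)) linear_sum scaler_sumr.
by apply: eq_bigr => j _; rewrite linearZ /= scalerA mxE.
Qed.

Lemma tens_basis (t : tensor) :
  t = \sum_i \sum_j t i j *: tens (vbasis {:U})`_i (vbasis {:V})`_j.
Proof.
rewrite [LHS]matrix_sum_delta; apply: eq_bigr => i _; apply: eq_bigr => j _.
congr (_ *: _); apply/matrixP=> k l; rewrite !mxE.
rewrite !coord_free ?(basis_free (vbasisP _)) //.
by rewrite -natrM mulnb [k == i]eq_sym [l == j]eq_sym.
Qed.

Lemma tensor_universal (W : vectType K) (b : U -> V -> W) :
  (forall y, linear (b^~ y)) -> (forall x, linear (b x)) ->
  exists! f : 'Hom(tensor, W), forall u v, f (tens u v) = b u v.
Proof.
move=> bl br; exists (linfun (tens_lift b)); split=> [u v|f fE].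
  by rewrite lfunE /= tens_liftE.
apply/lfunP=> t; rewrite lfunE /= [in RHS](tens_basis t) linear_sum.
apply: eq_bigr => i _; rewrite linear_sum.
by apply: eq_bigr => j _; rewrite linearZ /= fE.
Qed.

Lemma tensor_ext (W : vectType K) (f g : 'Hom(tensor, W)) :
  (forall u v, f (tens u v) = g (tens u v)) -> f = g.
Proof.
move=> fg; apply/lfunP=> t; rewrite (tens_basis t) !linear_sum.
apply: eq_bigr => i _; rewrite !linear_sum.
by apply: eq_bigr => j _; rewrite !linearZ /= fg.
Qed.

End Tensor.

Definition tens_map (K : fieldType) (U U' V V' : vectType K)
    (f : 'Hom(U, U')) (g : 'Hom(V, V')) : 'Hom(tensor U V, tensor U' V') :=
  linfun (tens_lift (fun u v => tens (f u) (g v))).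

Lemma tens_mapE (K : fieldType) (U U' V V' : vectType K)
    (f : 'Hom(U, U')) (g : 'Hom(V, V')) u v :
  tens_map f g (tens u v) = tens (f u) (g v).
Proof.
rewrite lfunE /= tens_liftE // => x a y z.
  by rewrite linearP tens_linearl.
by rewrite linearP tens_linearr.
Qed.

(* V / W, carried by the complement W^C: [quotv_pi] is linear and surjective
   with kernel W. *)
Section Quotient.
Variables (K : fieldType) (V : vectType K) (W : {vspace V}).

Definition quotv := subvs_of (W^C)%VS.
HB.instance Definition _ := Vector.on quotv.

Definition quotv_pi : 'Hom(V, quotv) :=
  (linfun (vsproj (W^C)%VS) \o (\1 - projv W))%VF.
Definition quotv_repr : 'Hom(quotv, V) := linfun (@vsval _ _ (W^C)%VS).

Lemma quotv_piE v : vsval (quotv_pi v) = v - projv W v.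
Proof.
by rewrite comp_lfunE lfunE /= !lfun_simp vsprojK // memv_projC.
Qed.

Lemma quotv_pi_eq0 v : (quotv_pi v == 0) = (v \in W).
Proof.
rewrite -(inj_eq val_inj) /= quotv_piE subr_eq0.
by apply/eqP/idP=> [->|/projv_id->//]; apply: memv_proj.
Qed.

Lemma quotv_reprK : cancel quotv_repr quotv_pi.
Proof.
move=> x; apply: val_inj; rewrite /= quotv_piE lfunE /=.
have /eqP-> : projv W (vsval x) == 0 by rewrite -memv_ker lker_proj subvsP.
by rewrite subr0.
Qed.

Lemma quotv_piK v : quotv_repr (quotv_pi v) - v \in W.
Proof. by rewrite -quotv_pi_eq0 linearB /= quotv_reprK subrr. Qed.

End Quotient.

Record bimodule (K : fieldType) (B C : falgType K) := Bimodule {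
  bimod_sort :> vectType K;
  lact : 'Hom(B, 'End(bimod_sort));
  ract : 'Hom(C, 'End(bimod_sort));
  lact1 : forall x, lact 1 x = x;
  ract1 : forall x, ract 1 x = x;
  lactM : forall a b x, lact (a * b) x = lact a (lact b x);
  ractM : forall a b x, ract (a * b) x = ract b (ract a x);
  lractC : forall a b x, lact a (ract b x) = ract b (lact a x)
}.

Section TensorBimodule.
Variables (K : fieldType) (B C : falgType K).

(* a (b ⊗ c) a' = ab ⊗ ca' *)
Definition tensor_lfun (a : B) : 'End(tensor B C) := tens_map (amull a) \1%VF.
Definition tensor_rfun (a : C) : 'End(tensor B C) := tens_map \1%VF (amulr a).

Fact tensor_lfun_is_linear : linear tensor_lfun.
Proof.
move=> k a b; apply: tensor_ext => u v.
rewrite add_lfunE scale_lfunE /tensor_lfun !tens_mapE !lfunE /=.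
by rewrite mulrDl -scalerAl tens_linearl.
Qed.
HB.instance Definition _ :=
  GRing.isLinear.Build K B 'End(tensor B C) _ tensor_lfun tensor_lfun_is_linear.

Fact tensor_rfun_is_linear : linear tensor_rfun.
Proof.
move=> k a b; apply: tensor_ext => u v.
rewrite add_lfunE scale_lfunE /tensor_rfun !tens_mapE !lfunE /=.
by rewrite mulrDr -scalerAr tens_linearr.
Qed.
HB.instance Definition _ :=
  GRing.isLinear.Build K C 'End(tensor B C) _ tensor_rfun tensor_rfun_is_linear.

Definition tensor_lact := linfun tensor_lfun.
Definition tensor_ract := linfun tensor_rfun.

Lemma tensor_lactE a u v : tensor_lact a (tens u v) = tens (a * u) v.
Proof. by rewrite lfunE /= tens_mapE !lfunE. Qed.

Lemma tensor_ractE a u v : tensor_ract a (tens u v) = tens u (v * a).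
Proof. by rewrite lfunE /= tens_mapE !lfunE. Qed.

Fact tensor_lact1 x : tensor_lact 1 x = x.
Proof.
suff -> : tensor_lact 1 = \1%VF by rewrite lfunE.
by apply: tensor_ext => u v; rewrite tensor_lactE mul1r lfunE.
Qed.

Fact tensor_ract1 x : tensor_ract 1 x = x.
Proof.
suff -> : tensor_ract 1 = \1%VF by rewrite lfunE.
by apply: tensor_ext => u v; rewrite tensor_ractE mulr1 lfunE.
Qed.

Fact tensor_lactM a b x :
  tensor_lact (a * b) x = tensor_lact a (tensor_lact b x).
Proof.
rewrite -comp_lfunE; congr (fun_of_lfun _ x); apply: tensor_ext => u v.
by rewrite comp_lfunE !tensor_lactE mulrA.
Qed.

Fact tensor_ractM a b x :
  tensor_ract (a * b) x = tensor_ract b (tensor_ract a x).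
Proof.
rewrite -comp_lfunE; congr (fun_of_lfun _ x); apply: tensor_ext => u v.
by rewrite comp_lfunE !tensor_ractE mulrA.
Qed.

Fact tensor_lractC a b x :
  tensor_lact a (tensor_ract b x) = tensor_ract b (tensor_lact a x).
Proof.
rewrite -!comp_lfunE; congr (fun_of_lfun _ x); apply: tensor_ext => u v.
by rewrite !comp_lfunE tensor_lactE !tensor_ractE tensor_lactE.
Qed.

Definition tensor_bimodule : bimodule B C :=
  Bimodule tensor_lact1 tensor_ract1 tensor_lactM tensor_ractM tensor_lractC.

End TensorBimodule.

Section QuotientBimodule.
Variables (K : fieldType) (B C : falgType K) (M : bimodule B C) (t : M).

(* The sub-bimodule generated by t, i.e. the image of B ⊗ C -> M,
   b ⊗ c |-> b t c; for commutative B = C and M = B ⊗ C this is the ideal (t). *)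
Definition gen_bimod : {vspace M} :=
  limg (linfun (tens_lift (fun (b : B) (c : C) => lact M b (ract M c t)))).

Lemma gen_bimodE b c : lact M b (ract M c t) \in gen_bimod.
Proof.
apply/memv_imgP; exists (tens b c); rewrite ?memvf // lfunE /= tens_liftE //.
  by move=> y k x x'; rewrite linearP !lfun_simp.
by move=> x k y y'; rewrite linearP !lfun_simp linearP.
Qed.

Lemma gen_bimod_ind (W : {vspace M}) :
  (forall b c, lact M b (ract M c t) \in W) -> (gen_bimod <= W)%VS.
Proof.
move=> sW; apply/subvP => _ /memv_imgP[x _ ->]; rewrite lfunE /=.
by apply: memv_suml => i _; apply: memv_suml => j _; apply/memvZ/sW.
Qed.

Lemma gen_bimod_l b x : x \in gen_bimod -> lact M b x \in gen_bimod.
Proof.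
suff /subvP sub : (gen_bimod <= lact M b @^-1: gen_bimod)%VS.
  by move/sub; rewrite -memv_preim.
by apply: gen_bimod_ind => b' c'; rewrite -memv_preim -lactM gen_bimodE.
Qed.

Lemma gen_bimod_r c x : x \in gen_bimod -> ract M c x \in gen_bimod.
Proof.
suff /subvP sub : (gen_bimod <= ract M c @^-1: gen_bimod)%VS.
  by move/sub; rewrite -memv_preim.
apply: gen_bimod_ind => b' c'.
by rewrite -memv_preim -lractC -ractM gen_bimodE.
Qed.

Lemma gen_bimod_min (W : {vspace M}) : t \in W ->
  (forall b x, x \in W -> lact M b x \in W) ->
  (forall c x, x \in W -> ract M c x \in W) -> (gen_bimod <= W)%VS.
Proof. by move=> Wt Wl Wr; apply: gen_bimod_ind => b c; apply/Wl/Wr. Qed.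

Local Notation pi := (quotv_pi gen_bimod).
Local Notation repr := (quotv_repr gen_bimod).

Definition quot_lfun (b : B) : 'End(quotv gen_bimod) :=
  (pi \o lact M b \o repr)%VF.
Definition quot_rfun (c : C) : 'End(quotv gen_bimod) :=
  (pi \o ract M c \o repr)%VF.

Lemma quot_lfunE b x : quot_lfun b x = pi (lact M b (repr x)).
Proof. by rewrite 2!comp_lfunE. Qed.

Fact quot_lfun_is_linear : linear quot_lfun.
Proof.
move=> k a b; apply/lfunP => x.
rewrite add_lfunE scale_lfunE !quot_lfunE linearD linearZ /=.
by rewrite add_lfunE scale_lfunE linearP.
Qed.
HB.instance Definition _ :=
  GRing.isLinear.Build K B 'End(quotv gen_bimod) _ quot_lfun quot_lfun_is_linear.

Lemma quot_rfunE b x : quot_rfun b x = pi (ract M b (repr x)).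
Proof. by rewrite 2!comp_lfunE. Qed.

Fact quot_rfun_is_linear : linear quot_rfun.
Proof.
move=> k a b; apply/lfunP => x.
rewrite add_lfunE scale_lfunE !quot_rfunE linearD linearZ /=.
by rewrite add_lfunE scale_lfunE linearP.
Qed.
HB.instance Definition _ :=
  GRing.isLinear.Build K C 'End(quotv gen_bimod) _ quot_rfun quot_rfun_is_linear.

Definition quot_lact := linfun quot_lfun.
Definition quot_ract := linfun quot_rfun.

Lemma quot_lactE b x : quot_lact b (pi x) = pi (lact M b x).
Proof.
rewrite lfunE /= quot_lfunE; apply/eqP; rewrite -subr_eq0 -!linearB /=.
by rewrite quotv_pi_eq0 gen_bimod_l ?quotv_piK.
Qed.

Lemma quot_ractE c x : quot_ract c (pi x) = pi (ract M c x).
Proof.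
rewrite lfunE /= quot_rfunE; apply/eqP; rewrite -subr_eq0 -!linearB /=.
by rewrite quotv_pi_eq0 gen_bimod_r ?quotv_piK.
Qed.

Fact quot_lact1 x : quot_lact 1 x = x.
Proof. by rewrite -[x]quotv_reprK quot_lactE lact1. Qed.

Fact quot_ract1 x : quot_ract 1 x = x.
Proof. by rewrite -[x]quotv_reprK quot_ractE ract1. Qed.

Fact quot_lactM a b x : quot_lact (a * b) x = quot_lact a (quot_lact b x).
Proof. by rewrite -[x]quotv_reprK !quot_lactE lactM. Qed.

Fact quot_ractM a b x : quot_ract (a * b) x = quot_ract b (quot_ract a x).
Proof. by rewrite -[x]quotv_reprK !quot_ractE ractM. Qed.

Fact quot_lractC a b x :
  quot_lact a (quot_ract b x) = quot_ract b (quot_lact a x).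
Proof.
by rewrite -[x]quotv_reprK !(quot_lactE, quot_ractE) lractC.
Qed.

Definition quot_bimodule : bimodule B C :=
  Bimodule quot_lact1 quot_ract1 quot_lactM quot_ractM quot_lractC.

End QuotientBimodule.

(* (b, x, c) stands for the matrix with rows (b, x) and (0, c). *)
Section Triangular.
Variables (K : fieldType) (B C : falgType K) (M : bimodule B C).

Definition triang : Type := B * M * C.
HB.instance Definition _ := Vector.on triang.

Implicit Types x y z : triang.

Definition triang_one : triang := (1, 0, 1).
Definition triang_mul x y : triang :=
  (x.1.1 * y.1.1, lact M x.1.1 y.1.2 + ract M y.2 x.1.2, x.2 * y.2).

Fact triang_mulA : associative triang_mul.
Proof.
move=> x y z; congr (_, _, _) => /=; rewrite ?mulrA //.
by rewrite !linearD /= lactM ractM lractC addrA.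
Qed.

Fact triang_mul1 : left_id triang_one triang_mul.
Proof.
by move=> [[b x] c]; rewrite /triang_mul /= !mul1r lact1 linear0 addr0.
Qed.

Fact triang_mulr1 : right_id triang_one triang_mul.
Proof.
by move=> [[b x] c]; rewrite /triang_mul /= !mulr1 ract1 linear0 add0r.
Qed.

Fact triang_mulDl : left_distributive triang_mul +%R.
Proof.
move=> [[b x] c] [[b' x'] c'] [[b'' x''] c'']; congr (_, _, _) => /=.
- by rewrite mulrDl.
- by rewrite !linearD /= !lfun_simp addrACA.
- by rewrite mulrDl.
Qed.

Fact triang_mulDr : right_distributive triang_mul +%R.
Proof.
move=> [[b x] c] [[b' x'] c'] [[b'' x''] c'']; congr (_, _, _) => /=.
- by rewrite mulrDr.
- by rewrite !linearD /= !lfun_simp addrACA.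
- by rewrite mulrDr.
Qed.

Fact triang_oner_neq0 : triang_one != 0.
Proof. by apply/eqP=> -[/eqP]; rewrite oner_eq0. Qed.

HB.instance Definition _ := GRing.Zmodule_isNzRing.Build triang
  triang_mulA triang_mul1 triang_mulr1 triang_mulDl triang_mulDr
  triang_oner_neq0.

Fact triang_scaleAl (k : K) x y : k *: (x * y) = k *: x * y.
Proof.
move: x y => [[b x] c] [[b' x'] c']; congr (_, _, _) => /=.
- by rewrite scalerAl.
- by rewrite scalerDr !linearZ /= !lfun_simp.
- by rewrite scalerAl.
Qed.
HB.instance Definition _ :=
  GRing.Lmodule_isLalgebra.Build K triang triang_scaleAl.

Fact triang_scaleAr (k : K) x y : k *: (x * y) = x * (k *: y).
Proof.
move: x y => [[b x] c] [[b' x'] c']; congr (_, _, _) => /=.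
- by rewrite scalerAr.
- by rewrite scalerDr !linearZ /= !lfun_simp.
- by rewrite scalerAr.
Qed.
HB.instance Definition _ :=
  GRing.Lalgebra_isAlgebra.Build K triang triang_scaleAr.

HB.instance Definition _ := Algebra_isFalgebra.Build K triang.

End Triangular.

HB.instance Definition _ (K : fieldType) (h : {poly K}) :=
  Vector.on {poly %/ h}.

Section Am1.
Variables (K : fieldType) (m : nat).

(* For m = 0, {poly %/ 'X^m} is K[X]/(X) and not the zero ring. *)
Definition Lambda : falgType K := {poly %/ ('X^m : {poly K})}.

Definition LambdaX : Lambda := 'qX.

Definition Gamma : bimodule Lambda Lambda :=
  @quot_bimodule K Lambda Lambda (tensor_bimodule Lambda Lambda)
    (tens (1 : Lambda) LambdaX + tens LambdaX (1 : Lambda)).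

Definition Am1 : falgType K := triang Gamma.

End Am1.

(* Main.v *)
Require Import Defs.
From HB Require Import structures.
From mathcomp Require Import all_boot all_order all_algebra all_field.
From mathcomp Require Import boolp classical_sets cardinality topology.
From mathcomp Require Import -(notations) mpoly.
From mathcomp Require Import ring zify.

Set Implicit Arguments.
Unset Strict Implicit.
Unset Printing Implicit Defensive.

Import GRing.Theory.
Local Open Scope ring_scope.

(* A module over A(m,1) of dimension d = p + q is, up to conjugation, a triple
   (A, B, H) with A^m = 0, B^m = 0 and A H = H B, that is, a homomorphism H of
   K[X]/(X^m)-modules; p is the rank of the image of the idempotent (1, 0, 0).
   The rank is locally constant, so it suffices to see that the triples of given
   (p, q) form an irreducible set. Call A generic if all its Jordan blocks but
   one have size m. The generic triples form a single orbit of pairs (A, B) with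
   a vector space of homomorphisms above it, so they are irreducible, and it
   remains to show that they are dense.

   If B has two blocks of sizes i <= j < m, with generators e and g, then (A, B, H)
   is a limit of triples for which the ranks of the powers of A and B are larger:
   - if A has a block of size l in [i, j], with generator a, then for H general
     there is a column phi, orthogonal to the submodule generated by a H, such that
       (A + t (H phi) w, B + t phi (w H), H)   with w = a A^(i-1)
     stays in the variety, and rank B^j jumps;
   - otherwise B + t g* e B^(i-1), where g* is the dual generator, turns the blocks
     (i, j) into (i-1, j+1), and H extends to a homomorphism H + t H1.
   Blocks of A are treated by transposition, and induction on the ranks of the
   powers ends at the generic triples. *)

(** * Rank one perturbations *)

Section MatrixPowers.
Variables (K : fieldType) (n : nat).
Implicit Types (A : 'M[K]_n) (v w : 'rV[K]_n) (c phi : 'cV[K]_n).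

Lemma mxpowD A s r : A ^+ (s + r) = A ^+ s *m A ^+ r.
Proof. exact: exprD. Qed.

Lemma mxpowS A s : A ^+ s.+1 = A *m A ^+ s.
Proof. exact: exprS. Qed.

Lemma mxpowSr A s : A ^+ s.+1 = A ^+ s *m A.
Proof. exact: exprSr. Qed.

Lemma row_pow_eq0 A v l s : v *m A ^+ l = 0 -> (l <= s)%N -> v *m A ^+ s = 0.
Proof. by move=> v0 /subnKC<-; rewrite mxpowD mulmxA v0 mul0mx. Qed.

Lemma col_pow_eq0 A c l s : A ^+ l *m c = 0 -> (l <= s)%N -> A ^+ s *m c = 0.
Proof. by move=> c0 /subnK<-; rewrite mxpowD -mulmxA c0 mulmx0. Qed.

Lemma trmx_pow A s : (A ^+ s)^T = A^T ^+ s.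
Proof.
elim: s => [|s IHs]; first by rewrite !expr0; exact: trmx1.
by rewrite (mxpowS A) trmx_mul IHs -mxpowSr.
Qed.

End MatrixPowers.

Lemma mxpow_comm (K : fieldType) n m (A : 'M[K]_n) (B : 'M[K]_m) (H : 'M[K]_(n, m)) s :
  A *m H = H *m B -> A ^+ s *m H = H *m B ^+ s.
Proof.
move=> AH; elim: s => [|s IHs]; first by rewrite !expr0 [LHS]mul1mx [RHS]mulmx1.
by rewrite mxpowSr -mulmxA AH mulmxA IHs mxpowSr mulmxA.
Qed.

Section RankOnePerturbation.
Variables (K : fieldType) (n : nat).
Implicit Types (A : 'M[K]_n) (v w : 'rV[K]_n) (c phi : 'cV[K]_n).

(* The derivative of A ^+ s in the direction of the rank one matrix phi w. *)
Definition dpow A phi w s : 'M[K]_n :=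
  \sum_(r < s) A ^+ r *m phi *m w *m A ^+ (s - r.+1).

Lemma dpowS A phi w s : dpow A phi w s.+1 = dpow A phi w s *m A + A ^+ s *m phi *m w.
Proof.
rewrite /dpow big_ord_recr /= subnn expr0 [X in _ + X = _]mulmx1 mulmx_suml.
congr (_ + _); apply: eq_bigr => r _.
by rewrite subSn // mxpowSr !mulmxA.
Qed.

Lemma dpow_kill A phi w s : (forall r, w *m A ^+ r *m phi = 0) ->
  dpow A phi w s *m phi = 0.
Proof.
move=> w0; rewrite mulmx_suml big1 // => r _.
by rewrite -mulmxA -(mulmxA _ w) (mulmxA w) w0 mulmx0.
Qed.

(** Every term of order at least two in [t] contains a factor w A^r phi, which vanishes, so the
    power is affine in [t]. *)
Lemma pow_perturb A phi w t s : (forall r, w *m A ^+ r *m phi = 0) ->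
  (A + t *: (phi *m w)) ^+ s = A ^+ s + t *: dpow A phi w s.
Proof.
move=> w0; elim: s => [|s IHs].
  by rewrite /dpow big_ord0 scaler0 addr0 !expr0.
rewrite mxpowSr IHs dpowS mulmxDl !mulmxDr -!scalemxAr -!scalemxAl.
rewrite [dpow _ _ _ _ *m (_ *m _)]mulmxA dpow_kill // mul0mx !scaler0 addr0.
by rewrite mxpowSr scalerDr -addrA [in LHS](addrC (t *: _)) mulmxA.
Qed.

(** The r-th term is A^r phi v A^(i+s-r-2). For r >= L it dies on the left; for r < L the right
    exponent is at least i + j - L >= l. *)
Lemma dpow_eq0 A phi v i j l L s : v *m A ^+ l = 0 -> A ^+ L *m phi = 0 ->
  (0 < i)%N -> (l + L <= i + j)%N -> (j < s)%N ->
  dpow A phi (v *m A ^+ i.-1) s = 0.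
Proof.
move=> v0 phi0 i0 lL js; apply: big1 => r _.
have [Lr|rL] := leqP L r; first by rewrite (col_pow_eq0 phi0) // !mul0mx.
rewrite -!mulmxA -mxpowD (row_pow_eq0 v0) ?mulmx0 //.
by have := ltn_ord r; lia.
Qed.

(** For s = j the same count leaves only r = L - 1, where the right exponent is exactly l - 1. *)
Lemma dpow_last A phi v i j l L : v *m A ^+ l = 0 -> A ^+ L *m phi = 0 ->
  (0 < i)%N -> (0 < L)%N -> (L <= j)%N -> (l + L = i + j)%N ->
  dpow A phi (v *m A ^+ i.-1) j = A ^+ L.-1 *m phi *m v *m A ^+ l.-1.
Proof.
move=> v0 phi0 i0 L0 Lj lL.
have Lj' : (L.-1 < j)%N by rewrite prednK.
rewrite /dpow (bigD1 (Ordinal Lj')) //= big1 => [|r rL].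
  rewrite addr0 -!mulmxA -mxpowD; do 3 congr (_ *m _); congr (_ ^+ _) => /=; lia.
have [Lr|rL'] := leqP L r; first by rewrite (col_pow_eq0 phi0) // !mul0mx.
rewrite -!mulmxA -mxpowD (row_pow_eq0 v0) ?mulmx0 //.
have : (r : nat) != L.-1 by []. have := ltn_ord r; move: L0 rL'; lia.
Qed.

(* By Wedderburn rank reduction: X is the Schur complement of a nonzero entry of
   the perturbed matrix. *)
Lemma rank_perturb (X : 'M[K]_n) (psi g' : 'cV[K]_n) (u g : 'rV[K]_n) t :
  g *m X = 0 -> X *m g' = 0 -> g *m psi != 0 -> u *m g' != 0 -> t != 0 ->
  (\rank X < \rank (X + t *: (psi *m u))%R)%N.
Proof.
move=> gX Xg gpsi ug t0; set Z := (Z in (_ < \rank Z)%N).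
have gZ : g *m Z = (t * (g *m psi) 0 0) *: u.
  rewrite /Z mulmxDr gX add0r -scalemxAr mulmxA -scalerA; congr (_ *: _).
  by rewrite {1}[g *m psi]mx11_scalar mul_scalar_mx.
have nz : t * (g *m psi) 0 0 != 0.
  rewrite mulf_neq0 //; apply: contraNneq gpsi => e.
  by apply/eqP/matrixP=> i j; rewrite !ord1 e mxE.
have uZ : (u <= Z)%MS.
  by rewrite -(eqmx_scale u nz) -gZ submxMl.
have XZ : (X <= Z)%MS.
  have -> : X = Z - t *: (psi *m u) by rewrite /Z addrK.
  by rewrite addmx_sub // eqmx_opp scalemx_sub // (submx_trans (submxMl _ _)).
have : (X < Z)%MS.
  rewrite ltmxE XZ /=; apply: contra ug => ZX.
  have /submxP[D ->] := submx_trans uZ ZX.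
  by rewrite -mulmxA Xg mulmx0.
by rewrite ltmxErank => /andP[].
Qed.

End RankOnePerturbation.

(** * Jordan strings *)

Section JordanSystems.
Variable K : fieldType.

Let false_mx : false%:R%:M = 0 :> 'M[K]_1.
Proof. exact: raddf0. Qed.

Definition jordan_sum n (A : 'M[K]_n) (I : finType) (l : I -> nat)
    (v : I -> 'rV[K]_n) (c : I -> 'cV[K]_n) : 'M[K]_n :=
  \sum_k \sum_(s < l k) A ^+ (l k - s.+1) *m c k *m (v k *m A ^+ s).

(** The pairings v_k A^s c_k' already make the strings and the columns A^(l_k-1-s) c_k dual
    families. [jordan_sum] is then the idempotent with the span of the strings as its row space, so
    strings of a direct summand are covered too. *)
Definition jordan_strings n (A : 'M[K]_n) (I : finType) (l : I -> nat)
    (v : I -> 'rV[K]_n) (c : I -> 'cV[K]_n) : Prop :=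
  [/\ forall k, v k *m A ^+ l k = 0,
      forall k, A ^+ l k *m c k = 0 &
      forall k k' s, v k *m A ^+ s *m c k' = ((k == k') && (s.+1 == l k))%:R%:M].

(* The Jordan strings v_k A^s (s < l_k) form a basis of the row space, and the
   columns A^(l_k-1-s) c_k form the dual basis. *)
Definition jordan_system n (A : 'M[K]_n) (I : finType) (l : I -> nat)
    (v : I -> 'rV[K]_n) (c : I -> 'cV[K]_n) : Prop :=
  jordan_strings A l v c /\ jordan_sum A l v c = 1%:M.

(** Multiplication by [A] shifts the columns, and both ends of the shifted sum vanish. With [tau]
    zero this builds homomorphisms; in general it solves A X = X B + Y, one string at a time. *)
Lemma string_sum_intertwine n m (A : 'M[K]_n) (B : 'M[K]_m) l (c : 'cV[K]_n)
    (rho tau : nat -> 'rV[K]_m) :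
  A ^+ l *m c = 0 -> rho l = 0 ->
  (forall s, (s < l)%N -> rho s.+1 = rho s *m B + tau s) ->
  A *m (\sum_(s < l) A ^+ (l - s.+1) *m c *m rho s) =
  (\sum_(s < l) A ^+ (l - s.+1) *m c *m rho s) *m B +
  \sum_(s < l) A ^+ (l - s.+1) *m c *m tau s.
Proof.
move=> c0 rho0 rhoS; rewrite mulmx_suml -big_split mulmx_sumr /=.
rewrite (eq_bigr (fun s : 'I_l => A ^+ (l - s) *m c *m rho s)); last first.
  move=> s _; rewrite !mulmxA; congr (_ *m _ *m _).
  by rewrite -mxpowS; congr (_ ^+ _); have := ltn_ord s; lia.
rewrite [RHS](eq_bigr (fun s : 'I_l => A ^+ (l - s.+1) *m c *m rho s.+1)); last first.
  by move=> s _; rewrite rhoS // mulmxDr !mulmxA.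
case: l c0 rho0 {rhoS} => [|l] c0 rho0; first by rewrite !big_ord0.
rewrite big_ord_recl /= subn0 c0 mul0mx add0r big_ord_recr /= rho0 mulmx0 addr0.
by apply: eq_bigr.
Qed.

(** In a Jordan system with [c] = c_k and u B^l = 0, this is the homomorphism that sends v_k to [u]
    and the other generators to 0. *)
Definition string_map n m (A : 'M[K]_n) (B : 'M[K]_m) l (c : 'cV[K]_n)
    (u : 'rV[K]_m) : 'M[K]_(n, m) :=
  \sum_(s < l) A ^+ (l - s.+1) *m c *m (u *m B ^+ s).

Lemma string_map_hom n m (A : 'M[K]_n) (B : 'M[K]_m) l (c : 'cV[K]_n)
    (u : 'rV[K]_m) : A ^+ l *m c = 0 -> u *m B ^+ l = 0 ->
  A *m string_map A B l c u = string_map A B l c u *m B.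
Proof.
move=> c0 u0; rewrite /string_map.
rewrite (@string_sum_intertwine _ _ A B l c (fun s => u *m B ^+ s) (fun=> 0)) //.
  by rewrite [X in _ + X]big1 ?addr0 // => s _; rewrite mulmx0.
by move=> s _; rewrite addr0 mxpowSr mulmxA.
Qed.

Lemma string_map_eval n m (A : 'M[K]_n) (B : 'M[K]_m) l
    (v : 'rV[K]_n) (c : 'cV[K]_n) (u : 'rV[K]_m) : (0 < l)%N ->
  (forall s, v *m A ^+ s *m c = (s.+1 == l)%:R%:M) ->
  v *m string_map A B l c u = u.
Proof.
case: l => // l _ vc; rewrite mulmx_sumr big_ord_recl big1 => [|s _].
  rewrite addr0 subSS subn0 !mulmxA vc eqxx mul1mx expr0; exact: mulmx1.
rewrite !mulmxA vc (_ : (_ == _) = false) ?raddf0 ?mul0mx //.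
by apply/negbTE; rewrite /= /bump; have := ltn_ord s; lia.
Qed.

Lemma jordan_strings_tr n (A : 'M[K]_n) (I : finType) l v c :
  @jordan_strings n A I l v c -> jordan_strings A^T l (fun k => (c k)^T) (fun k => (v k)^T).
Proof.
move=> [vA Ac vc]; split=> [k|k|k k' s].
- by rewrite -trmx_pow -trmx_mul Ac trmx0.
- by rewrite -trmx_pow -trmx_mul vA trmx0.
- rewrite -trmx_pow -!trmx_mul mulmxA vc tr_scalar_mx.
  by case: (eqVneq k' k) => [->|]; rewrite ?eqxx // eq_sym => /negbTE->.
Qed.

Lemma jordan_system_tr n (A : 'M[K]_n) (I : finType) l v c :
  @jordan_system n A I l v c -> jordan_system A^T l (fun k => (c k)^T) (fun k => (v k)^T).
Proof.
move=> [/jordan_strings_tr ? vc1]; split=> //; rewrite -trmx1 -vc1 linear_sum.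
apply: eq_bigr => k _; rewrite linear_sum (reindex_inj rev_ord_inj).
apply: eq_bigr => s _ /=; rewrite !trmx_mul !trmx_pow !mulmxA.
by congr (_ ^+ _ *m _ *m _ *m _ ^+ _); have := ltn_ord s; lia.
Qed.

(** Start from a column that pairs to 1 with v A^k, then make the pairings with v A^s vanish for s =
    k - 1, ..., 0 in turn. *)
Lemma maximal_string_dual n (A F : 'M[K]_n) k (v : 'rV[K]_n) :
  F *m F = F -> F *m A = A *m F -> v *m F = v -> v *m A ^+ k != 0 -> F *m A ^+ k.+1 = 0 ->
  exists c : 'cV[K]_n, F *m c = c /\ forall s, v *m A ^+ s *m c = (s == k)%:R%:M.
Proof.
move=> FF FA vF vAk FAk.
have vA0 s : (k < s)%N -> v *m A ^+ s = 0.
  by move=> ks; rewrite -vF -mulmxA -(subnKC ks) mxpowD (mulmxA F) FAk mul0mx mulmx0.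
have FAs s : F *m A ^+ s = A ^+ s *m F by rewrite (mxpow_comm s (esym FA)).
suff H a : (a <= k)%N -> exists c : 'cV[K]_n, F *m c = c /\
    forall s, (k - a <= s)%N -> v *m A ^+ s *m c = (s == k)%:R%:M.
  have [c [Fc cE]] := H k (leqnn k).
  by exists c; split=> // s; apply: cE; rewrite subnn.
elim: a => [_|a IHa ak].
  have /rV0Pn[j uj] := vAk; pose d : 'cV[K]_n := ((v *m A ^+ k) 0 j)^-1 *: delta_mx j 0.
  have vd : v *m A ^+ k *m d = 1%:M.
    rewrite -scalemxAr -colE; apply/matrixP=> x y.
    by rewrite !ord1 mxE [col _ _ _ _]mxE mulVf // mxE eqxx.
  exists (F *m d); split=> [|s]; first by rewrite mulmxA FF.
  rewrite subn0 leq_eqVlt => /predU1P[<-|ks].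
    by rewrite mulmxA -(mulmxA v) -FAs mulmxA vF vd eqxx.
  by rewrite vA0 // mul0mx gtn_eqF // false_mx.
have [c [Fc cE]] := IHa (ltnW ak).
(* The subtracted multiple of A^(a+1) c cancels the pairing at s = k - a - 1, because v A^k c = 1.
   The pairings at larger s are unchanged, since v A^(s+a+1) = 0 there. *)
exists (c - A ^+ a.+1 *m c *m (v *m A ^+ (k - a.+1) *m c)); split=> [|s].
  by rewrite mulmxBr !mulmxA FAs -(mulmxA _ F) Fc.
rewrite leq_eqVlt => /predU1P[<-|ks]; rewrite mulmxBr !mulmxA.
  rewrite -(mulmxA v _ (A ^+ a.+1)) -mxpowD subnK // (cE k) ?leq_subr // eqxx mul1mx subrr.
  by rewrite ltn_eqF ?false_mx //; lia.
rewrite -(mulmxA v _ (A ^+ a.+1)) -mxpowD (vA0 (s + a.+1)%N) ?mul0mx ?subr0; last lia.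
by rewrite cE //; lia.
Qed.

(** [E] is the endomorphism that sends [v] to itself, with image the cyclic submodule generated by
    [v]; so it fixes its image. *)
Lemma cyclic_proj n (A : 'M[K]_n) k (v : 'rV[K]_n) (c : 'cV[K]_n) (E := string_map A A k.+1 c v) :
  v *m A ^+ k.+1 = 0 -> A ^+ k.+1 *m c = 0 ->
  (forall s, v *m A ^+ s *m c = (s == k)%:R%:M) ->
  [/\ v *m E = v, E *m c = c, E *m E = E & E *m A = A *m E].
Proof.
move=> vA Ac vc; have EA : E *m A = A *m E by rewrite string_map_hom.
have vE : v *m E = v by apply: string_map_eval.
split=> //.
  rewrite mulmx_suml big_ord_recr /= subnn expr0 mul1mx big1 => [|s _].
    by rewrite add0r -mulmxA vc eqxx mulmx1.
  by rewrite -mulmxA vc ltn_eqF // false_mx mulmx0.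
rewrite {1 3}/E /string_map mulmx_suml; apply: eq_bigr => s _.
by rewrite -!mulmxA (mxpow_comm s (esym EA)) (mulmxA v) vE.
Qed.

(* A string of maximal length splits off from the image of an idempotent F
   commuting with A. *)
Lemma jordan_system_exists n (A : 'M[K]_n) m : A ^+ m = 0 ->
  forall F : 'M[K]_n, F *m F = F -> F *m A = A *m F ->
  exists (I : finType) (l : I -> nat) v c,
   [/\ forall k, (0 < l k)%N, forall k, v k *m F = v k, forall k, F *m c k = c k,
      jordan_strings A l v c & jordan_sum A l v c = F].
Proof.
move=> Am F; elim: {F}_.+1 {-2}F (ltnSn (\rank F)) => // r IHr F Fr FF FA.
have [F0|F0] := eqVneq F 0.
  exists void, (fun=> 0%N), (fun=> 0), (fun=> 0).
  by rewrite /jordan_sum big_pred0 ?F0 //; split=> //; split=> [[]|[]|[]].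
have [k [FAk FAk1]] : exists k, F *m A ^+ k != 0 /\ F *m A ^+ k.+1 = 0.
  have ex : exists k, F *m A ^+ k == 0 by exists m; rewrite Am; apply/eqP; exact: mulmx0.
  case: (ex_minnP ex) => -[|k] /eqP FAk mink.
    by rewrite expr0 [LHS]mulmx1 in FAk; rewrite FAk eqxx in F0.
  by exists k; split=> //; apply/negP => /mink; rewrite ltnn.
have /rowV0Pn[u /submxP[D uE] u0] := FAk.
have FAs s : F *m A ^+ s = A ^+ s *m F by rewrite (mxpow_comm s (esym FA)).
have [v vF vAk] : exists2 v : 'rV_n, v *m F = v & v *m A ^+ k != 0.
  by exists (D *m F); rewrite -mulmxA ?FF // -uE.
have [c [Fc vc]] := maximal_string_dual FF FA vF vAk FAk1.
have vA : v *m A ^+ k.+1 = 0 by rewrite -vF -mulmxA FAk1 mulmx0.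
have Ac : A ^+ k.+1 *m c = 0 by rewrite -Fc mulmxA -FAs FAk1 mul0mx.
have [] := cyclic_proj vA Ac vc; set E := string_map _ _ _ _ _ => vE Ec EE EA.
have FE : F *m E = E.
  rewrite mulmx_sumr; apply: eq_bigr => s _.
  by rewrite !mulmxA FAs -(mulmxA _ F) Fc.
have EF : E *m F = E.
  rewrite mulmx_suml; apply: eq_bigr => s _.
  by rewrite -!mulmxA -FAs (mulmxA v) vF.
have FEFE : (F - E) *m (F - E) = F - E.
  by rewrite mulmxBl !mulmxBr FF FE EF EE subrr subr0.
(* [F - E] projects onto a complement of the cyclic submodule inside the image of [F]; it kills [v],
   so its rank is smaller. *)
have [|||I [l [v' [c' [l0 v'F Fc' [v'A Ac' vc'] sumF]]]]] := IHr (F - E).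
- rewrite -ltnS (leq_trans _ Fr) // ltnS.
  have lt : ((F - E)%R < F)%MS.
    rewrite ltmxE; apply/andP; split.
      by rewrite -[X in (X <= _)%MS](_ : (F - E) *m F = _) ?submxMl // mulmxBl FF EF.
    apply/negP => sFE; have /submxP[D' vD'] : (v <= (F - E)%R)%MS.
      by apply: submx_trans sFE; rewrite -vF submxMl.
    have v0 : v *m (F - E) = 0 by rewrite mulmxBr vF vE subrr.
    by move: vAk; rewrite vD' -FEFE mulmxA -vD' v0 mul0mx eqxx.
  by move: lt; rewrite ltmxErank => /andP[].
- exact: FEFE.
- by rewrite mulmxBl mulmxBr FA EA.
exists (unit + I)%type, (fun x => if x is inr i then l i else k.+1),
  (fun x => if x is inr i then v' i else v),
  (fun x => if x is inr i then c' i else c).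
have FEE : (F - E) *m E = 0 by rewrite mulmxBl FE EE subrr.
have EFE : E *m (F - E) = 0 by rewrite mulmxBr EF EE subrr.
have AE s : A ^+ s *m E = E *m A ^+ s by rewrite (mxpow_comm s (esym EA)).
split.
- by case.
- by case=> [_|i] //=; rewrite -{1}v'F -mulmxA mulmxBl FF EF v'F.
- by case=> [_|i] //=; rewrite -{1}Fc' mulmxA mulmxBr FF FE Fc'.
(* The new string and the old ones are orthogonal because E (F - E) and (F - E) E both vanish. *)
- split=> [[]|[]|[[]|i] [[]|i'] s] //=.
  + rewrite -vE -Fc' -!mulmxA (mulmxA E) -AE -!mulmxA (mulmxA E) EFE.
    by rewrite mul0mx !mulmx0 raddf0.
  + rewrite -v'F -Ec -!mulmxA (mulmxA _ E) AE -!mulmxA (mulmxA _ E) FEE.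
    by rewrite mul0mx mulmx0 raddf0.
rewrite /jordan_sum big_sumType /= -/(jordan_sum A l v' c') sumF.
rewrite (big_pred1 tt) /=; last by case.
by rewrite addrC subrK.
Qed.

End JordanSystems.

Lemma big_option (R : Type) (idx : R) (op : Monoid.com_law idx) (I : finType)
    (F : option I -> R) :
  \big[op/idx]_k F k = op (F None) (\big[op/idx]_i F (Some i)).
Proof.
rewrite (bigD1 None) //=; congr (op _ _).
rewrite (reindex_omap Some id) /=; last by case.
by apply: eq_bigl => i; rewrite eqxx.
Qed.

(** * Conjugacy of generic nilpotent matrices *)

Section Sim.
Variable K : fieldType.

Lemma jordan_strings_pair n (A : 'M[K]_n) (I : finType) l v c k k' s s' :
  @jordan_strings K n A I l v c -> (s < l k)%N -> (s' < l k')%N ->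
  v k *m A ^+ s *m (A ^+ (l k' - s'.+1) *m c k') =
  ((k == k') && (s == s'))%:R%:M.
Proof.
move=> [_ _ vc] sl sl'; rewrite !mulmxA -(mulmxA (v k) (A ^+ s)) -mxpowD vc.
case: eqVneq => //= kk; subst k'; congr (_%:R%:M); congr nat_of_bool.
by apply/eqP/eqP; lia.
Qed.

Lemma jordan_strings_map n n' (A : 'M[K]_n) (B : 'M[K]_n') (I : finType) l v c
    (v' : I -> 'rV[K]_n') k s :
  jordan_strings A l v c -> (s < l k)%N ->
  v k *m A ^+ s *m (\sum_k' string_map A B (l k') (c k') (v' k')) = v' k *m B ^+ s.
Proof.
move=> oA sl; rewrite mulmx_sumr (bigD1 k) //= [X in _ + X]big1 => [|k' k'k].
  rewrite addr0 mulmx_sumr (bigD1 (Ordinal sl)) //= [X in _ + X]big1 => [|s' s's].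
    by rewrite addr0 [LHS]mulmxA (jordan_strings_pair oA) // !eqxx mul1mx.
  rewrite [LHS]mulmxA (jordan_strings_pair oA) // eqxx /=.
  by rewrite (_ : s == s' = false) ?raddf0 ?mul0mx // eq_sym; apply/negbTE.
rewrite mulmx_sumr big1 // => s' _; rewrite [LHS]mulmxA (jordan_strings_pair oA) //.
by rewrite eq_sym (negbTE k'k) raddf0 mul0mx.
Qed.

(** One homomorphism sends each generator v_k to v'_k and the other sends it back, so both
    composites fix every string. *)
Lemma jordan_system_sim n n' (A : 'M[K]_n) (B : 'M[K]_n') (I : finType) l v c v' c' :
  @jordan_system K n A I l v c -> @jordan_system K n' B I l v' c' ->
  exists (g : 'M[K]_(n, n')) (h : 'M[K]_(n', n)),
    [/\ g *m h = 1%:M, h *m g = 1%:M & A *m g = g *m B].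
Proof.
move=> [oA sA] [oB sB].
exists (\sum_k string_map A B (l k) (c k) (v' k)),
       (\sum_k string_map B A (l k) (c' k) (v k)); split.
- rewrite -[LHS]mul1mx -{1}sA /jordan_sum mulmx_suml -sA; apply: eq_bigr => k _.
  rewrite mulmx_suml; apply: eq_bigr => s _.
  by rewrite -mulmxA (mulmxA (v k *m _)) !jordan_strings_map.
- rewrite -[LHS]mul1mx -{1}sB /jordan_sum mulmx_suml -sB; apply: eq_bigr => k _.
  rewrite mulmx_suml; apply: eq_bigr => s _.
  by rewrite -mulmxA (mulmxA (v' k *m _)) !jordan_strings_map.
- rewrite mulmx_sumr mulmx_suml; apply: eq_bigr => k _.
  by rewrite string_map_hom //; [case: oA | case: oB].
Qed.

(** The strings are the rows of [U] and the dual basis the columns of [W]. These are mutually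
    inverse, so there are as many strings as coordinates. *)
Lemma jordan_system_size n (A : 'M[K]_n) (I : finType) l v c :
  @jordan_system K n A I l v c -> (\sum_k l k = n)%N.
Proof.
move=> [oA sA]; pose T := {k : I & 'I_(l k)}; pose ev (a : 'I_#|{: T}|) : T := enum_val a.
pose U : 'M[K]_(#|{: T}|, n) :=
  \matrix_(a, j) (v (tag (ev a)) *m A ^+ tagged (ev a)) 0 j.
pose W : 'M[K]_(n, #|{: T}|) :=
  \matrix_(j, a) (A ^+ (l (tag (ev a)) - (tagged (ev a)).+1) *m c (tag (ev a))) j 0.
have UW : U *m W = 1%:M.
  apply/matrixP=> a b; rewrite [LHS]mxE.
  transitivity ((v (tag (ev a)) *m A ^+ tagged (ev a) *m
    (A ^+ (l (tag (ev b)) - (tagged (ev b)).+1) *m c (tag (ev b)))) 0 0).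
    by rewrite [RHS]mxE; apply: eq_bigr => j _; rewrite !mxE.
  rewrite (jordan_strings_pair oA) // !mxE mulr1n; congr (_%:R); congr nat_of_bool.
  rewrite -(inj_eq enum_val_inj).
  rewrite -!/(ev _); case: (ev a) (ev b) => [k s] [k' s'] /=.
  rewrite -tag_eqE /tag_eq /=; case: eqVneq => //= kk; subst k'.
  by rewrite tagged_asE.
have WU : W *m U = 1%:M.
  rewrite -sA; apply/matrixP=> i j; rewrite mxE /jordan_sum.
  transitivity (\sum_(x : T) (A ^+ (l (tag x) - (tagged x).+1) *m c (tag x) *m
     (v (tag x) *m A ^+ tagged x)) i j).
    rewrite [RHS](reindex (@enum_val _ {: T})) /=; last exact/onW_bij/enum_val_bij.
    by apply: eq_bigr => a _; rewrite !mxE big_ord1 !mxE.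
  rewrite summxE; under [RHS]eq_bigr do rewrite summxE.
  by rewrite sig_big_dep; apply: eq_bigl.
have -> : (\sum_k l k = #|{: T}|)%N.
  by rewrite card_tagged sumnE big_map big_enum; apply: eq_bigr => k _; rewrite card_ord.
by apply/eqP; rewrite eqn_leq (mulmx1_min UW) (mulmx1_min WU).
Qed.

Lemma jordan_block_le n (A : 'M[K]_n) (I : finType) l v c m k :
  @jordan_system K n A I l v c -> A ^+ m = 0 -> (l k <= m)%N.
Proof.
move=> [[_ _ vc] _] Am; case lk: (l k) => [|s] //; rewrite ltnNge; apply/negP => ms.
have := vc k k s; rewrite lk !eqxx -(subnK ms) mxpowD Am mulmx0 mulmx0 mul0mx.
by move/matrixP/(_ 0 0)/eqP; rewrite !mxE eq_sym oner_eq0.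
Qed.

(* The block indexed by None is empty when r = 0. *)
Definition generic m n (A : 'M[K]_n) : Prop :=
  exists a r (v : option 'I_a -> 'rV[K]_n) (c : option 'I_a -> 'cV[K]_n),
  (r < m)%N /\ jordan_system A (fun k => if k is Some _ then m else r) v c.

(** Since n = a m + r with r < m, Euclidean division determines the Jordan type of a generic matrix
    of size n. *)
Lemma generic_sim m n (A B : 'M[K]_n) : generic m A -> generic m B ->
  exists g : 'M[K]_n, g \in unitmx /\ A *m g = g *m B.
Proof.
move=> [a [r [v [c [rm sA]]]]] [a' [r' [v' [c' [rm' sB]]]]].
have szA := jordan_system_size sA; have szB := jordan_system_size sB.
have [ea er] : a = a' /\ r = r'.
  have sumE b x : (\sum_(k : option 'I_b) (if k is Some _ then m else x) = b * m + x)%N.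
    by rewrite big_option /= sum_nat_const card_ord addnC.
  have e : (a * m + r = a' * m + r')%N by rewrite -!sumE szA.
  move: (congr1 (divn^~ m) e) (congr1 (modn^~ m) e).
  by rewrite !divnMDl ?(divn_small rm) ?(divn_small rm') ?addn0 ?modnMDl ?modn_small //; lia.
subst a' r'; have [g [h [gh _ AgB]]] := jordan_system_sim sA sB.
by exists g; have [] := mulmx1_unit gh.
Qed.

Lemma jordan_system_reindex n (A : 'M[K]_n) (I J : finType) l v c (h : J -> I) :
  bijective h -> @jordan_system K n A I l v c -> jordan_system A (l \o h) (v \o h) (c \o h).
Proof.
move=> hB [[vA Ac vc] sA]; split; first split=> [k|k|k k' s] //=.
  by rewrite vc (inj_eq (bij_inj hB)).
by rewrite -sA /jordan_sum (reindex h) //; apply: onW_bij.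
Qed.

(** The added empty string plays the exceptional block of a generic matrix when all the blocks have
    size m. *)
Lemma jordan_system_pad n (A : 'M[K]_n) (I : finType) l v c : @jordan_system K n A I l v c ->
  jordan_system A (fun k => if k is Some i then l i else 0%N)
    (fun k => if k is Some i then v i else 0) (fun k => if k is Some i then c i else 0).
Proof.
move=> [[vA Ac vc] sA]; split; first split=> [[k|]|[k|]|[k|] [k'|] s] //=.
- by rewrite mul0mx.
- by rewrite mulmx0.
- by rewrite mulmx0 raddf0.
- by rewrite !mul0mx raddf0.
- by rewrite !mul0mx raddf0.
- by rewrite /jordan_sum big_option /= big_ord0 add0r.
Qed.

Lemma jordan_system_generic n (A : 'M[K]_n) (I : finType) l v c m (k0 : I) :
  @jordan_system K n A I l v c -> (l k0 < m)%N -> (forall k, k != k0 -> l k = m) ->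
  generic m A.
Proof.
move=> sA lk0 lk; pose S := [pred k | k != k0].
pose h (x : option 'I_#|S|) := if x is Some a then enum_val a else k0.
have hB : bijective h.
  apply: inj_card_bij.
    move=> [a|] [b|] //=; first by move/enum_val_inj->.
      by have := enum_valP a; rewrite inE /= => /negP n1 e; case: n1; rewrite e.
    by have := enum_valP b; rewrite inE /= => /negP n1 e; case: n1; rewrite -e.
  by rewrite card_option card_ord (cardD1 k0) add1n ltnS subset_leq_card //;
     apply/fintype.subsetP=> x; rewrite !inE andbT.
exists #|S|, (l k0), (v \o h), (c \o h); split=> //.
have := jordan_system_reindex hB sA; congr (jordan_system _ _ _ _).
apply/funext => -[a|] //=; apply: lk; exact: (enum_valP a).
Qed.

Lemma generic_or_pair n (A : 'M[K]_n) (I : finType) l v c m :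
  @jordan_system K n A I l v c -> A ^+ m = 0 -> (0 < m)%N -> (forall k, 0 < l k)%N ->
  generic m A \/ exists k k' : I, [/\ k != k', (l k <= l k')%N & (l k' < m)%N].
Proof.
move=> sA Am m0 l0.
have [/existsP[k0 lk0]|/existsPn nl] := boolP [exists k, (l k < m)%N]; last first.
  left; apply: (jordan_system_generic (k0 := None) (jordan_system_pad sA)) => // -[k _|] //.
  by apply/eqP; rewrite eqn_leq (jordan_block_le k sA Am) leqNgt nl.
have [/existsP[k1 /andP[k10 lk1]]|/existsPn nl] :=
    boolP [exists k, (k != k0) && (l k < m)%N].
  right; have [le|/ltnW le] := leqP (l k0) (l k1).
    by exists k0, k1; rewrite eq_sym.
  by exists k1, k0.
left; apply: (jordan_system_generic sA lk0) => k kk0; apply/eqP.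
by rewrite eqn_leq (jordan_block_le k sA Am) leqNgt; have := nl k; rewrite kk0.
Qed.

End Sim.

(** * Rational curves *)

Section RationalCurves.
Variable K : closedFieldType.
Implicit Types (d r : {poly K}) (f : K -> K) (P : K -> Prop).

(** An algebraically closed field is infinite: at a root t of r X + 1 one has r(t) t = -1. *)
Lemma poly_nonroot r : r != 0 -> exists t, r.[t] != 0.
Proof.
move=> r0; have [t] : exists t, root (r * 'X + 1) t.
  apply/closed_rootP; rewrite size_polyDl size_mulX // ?eqSS ?size_poly_eq0 //.
  by rewrite size_poly1 ltnS size_poly_gt0.
rewrite /root !hornerE => rt; exists t; apply: contraTneq rt => ->.
by rewrite mul0r add0r oner_eq0.
Qed.

(** That is, for all but finitely many values. [almost_and] and [almost_ex] together express the
    irreducibility of the affine line. *)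
Definition almost P := exists2 r, r != 0 & forall t, r.[t] != 0 -> P t.

Lemma almost_ex P : almost P -> exists t, P t.
Proof. by move=> [r /poly_nonroot[t rt] rP]; exists t; apply: rP. Qed.

Lemma almost_imp P Q : (forall t, P t -> Q t) -> almost P -> almost Q.
Proof. by move=> PQ [r r0 rP]; exists r => // t /rP/PQ. Qed.

Lemma almostT P : (forall t, P t) -> almost P.
Proof. by move=> allP; exists 1; rewrite ?oner_eq0. Qed.

Lemma almost_and P Q : almost P -> almost Q -> almost (fun t => P t /\ Q t).
Proof.
move=> [r r0 rP] [s s0 sQ]; exists (r * s); first by rewrite mulf_neq0.
by move=> t; rewrite hornerM mulf_eq0 => /norP[/rP ? /sQ ?].
Qed.

Lemma almost_all n (P : nat -> K -> Prop) :
  (forall s, (s < n)%N -> almost (P s)) ->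
  almost (fun t => forall s, (s < n)%N -> P s t).
Proof.
elim: n => [|n IHn] aP; first exact: almostT.
have aP' : almost (fun t => forall s, (s < n)%N -> P s t).
  by apply: IHn => s sn; apply: aP; apply: ltnW.
apply: almost_imp (almost_and aP' (aP n (ltnSn n))) => t [Pt Pn] s.
by rewrite ltnS leq_eqVlt => /predU1P[->|/Pt].
Qed.

Lemma almost_neq c : almost (fun t => t != c).
Proof.
exists ('X - c%:P); first by rewrite polyXsubC_eq0.
by move=> t; rewrite hornerXsubC subr_eq0.
Qed.

(** Regular functions on the open subset of the line where [d] does not vanish; values at the roots
    of [d] are arbitrary. For d = 1 these are the polynomial functions. *)
Definition ratfun d f :=
  exists N r, forall t, d.[t] != 0 -> f t * d.[t] ^+ N = r.[t].

Lemma ratfun_almost d f t0 : ratfun d f -> d.[t0] != 0 -> f t0 != 0 ->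
  almost (fun t => f t != 0 /\ d.[t] != 0).
Proof.
move=> [N [r fr]] d0 f0.
have nz s : s.[t0] != 0 -> s != 0 by apply: contraNneq => ->; rewrite horner0.
exists (r * d); first by rewrite mulf_neq0 // nz // -fr // mulf_neq0 // expf_neq0.
move=> t; rewrite hornerM mulf_eq0 => /norP[rt dt]; split=> //.
by move: rt; rewrite -fr // mulf_eq0 => /norP[].
Qed.

Lemma ratfun_eq d f g : (forall t, d.[t] != 0 -> f t = g t) -> ratfun d f -> ratfun d g.
Proof. by move=> fg [N [r fr]]; exists N, r => t dt; rewrite -fg // fr. Qed.

Lemma ratfun_poly d r : ratfun d (fun t => r.[t]).
Proof. by exists 0%N, r => t _; rewrite mulr1. Qed.

Lemma ratfun_const d c : ratfun d (fun=> c).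
Proof. by apply: ratfun_eq (ratfun_poly d c%:P) => t _; rewrite hornerC. Qed.

Lemma ratfun_id d : ratfun d id.
Proof. by apply: ratfun_eq (ratfun_poly d 'X) => t _; rewrite hornerX. Qed.

Lemma ratfun_inv d : ratfun d (fun t => d.[t]^-1).
Proof. by exists 1%N, 1 => t dt; rewrite mulVf // hornerC. Qed.

Lemma ratfunD d f g : ratfun d f -> ratfun d g -> ratfun d (fun t => f t + g t).
Proof.
move=> [N [r fr]] [M [s gs]]; exists (N + M)%N, (r * d ^+ M + s * d ^+ N) => t dt.
by rewrite !hornerE -fr // -gs // exprD; ring.
Qed.

Lemma ratfunM d f g : ratfun d f -> ratfun d g -> ratfun d (fun t => f t * g t).
Proof.
move=> [N [r fr]] [M [s gs]]; exists (N + M)%N, (r * s) => t dt.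
by rewrite !hornerE -fr // -gs // exprD; ring.
Qed.

Lemma ratfun_sum d (I : Type) (s : seq I) (Q : pred I) (F : I -> K -> K) :
  (forall i, ratfun d (F i)) -> ratfun d (fun t => \sum_(i <- s | Q i) F i t).
Proof.
move=> Fr; elim: s => [|i s IHs].
  by apply: ratfun_eq (ratfun_const d 0) => t _; rewrite big_nil.
case Qi: (Q i); last by apply: ratfun_eq IHs => t _; rewrite big_cons Qi.
by apply: ratfun_eq (ratfunD (Fr i) IHs) => t _; rewrite big_cons Qi.
Qed.

Lemma ratfun_prod d (I : Type) (s : seq I) (Q : pred I) (F : I -> K -> K) :
  (forall i, ratfun d (F i)) -> ratfun d (fun t => \prod_(i <- s | Q i) F i t).
Proof.
move=> Fr; elim: s => [|i s IHs].
  by apply: ratfun_eq (ratfun_const d 1) => t _; rewrite big_nil.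
case Qi: (Q i); last by apply: ratfun_eq IHs => t _; rewrite big_cons Qi.
by apply: ratfun_eq (ratfunM (Fr i) IHs) => t _; rewrite big_cons Qi.
Qed.

Lemma ratfunX d f n : ratfun d f -> ratfun d (fun t => f t ^+ n).
Proof.
move=> fr; elim: n => [|n IHn]; first exact: ratfun_const.
by apply: ratfun_eq (ratfunM fr IHn) => t _; rewrite exprS.
Qed.

Definition ratmx d m n (X : K -> 'M[K]_(m, n)) := forall i j, ratfun d (fun t => X t i j).

Lemma ratmx_eq d m n (X Y : K -> 'M[K]_(m, n)) :
  (forall t, d.[t] != 0 -> X t = Y t) -> ratmx d X -> ratmx d Y.
Proof. by move=> XY rX i j; apply: ratfun_eq (rX i j) => t dt; rewrite XY. Qed.

Lemma ratmx_const d m n (X : 'M[K]_(m, n)) : ratmx d (fun=> X).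
Proof. by move=> i j; apply: ratfun_const. Qed.

Lemma ratmxD d m n (X Y : K -> 'M[K]_(m, n)) :
  ratmx d X -> ratmx d Y -> ratmx d (fun t => X t + Y t).
Proof.
by move=> rX rY i j; apply: ratfun_eq (ratfunD (rX i j) (rY i j)) => t _; rewrite mxE.
Qed.

Lemma ratmxZ d m n f (X : K -> 'M[K]_(m, n)) :
  ratfun d f -> ratmx d X -> ratmx d (fun t => f t *: X t).
Proof.
by move=> rf rX i j; apply: ratfun_eq (ratfunM rf (rX i j)) => t _; rewrite mxE.
Qed.

Lemma ratmxM d m n k (X : K -> 'M[K]_(m, n)) (Y : K -> 'M[K]_(n, k)) :
  ratmx d X -> ratmx d Y -> ratmx d (fun t => X t *m Y t).
Proof.
move=> rX rY i j.
apply: (@ratfun_eq _ (fun t => \sum_k X t i k * Y t k j)) => [t _|]; first by rewrite mxE.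
by apply: ratfun_sum => x; apply: ratfunM.
Qed.

Lemma ratmxX d n (X : K -> 'M[K]_n) s : ratmx d X -> ratmx d (fun t => X t ^+ s).
Proof.
move=> rX; elim: s => [|s IHs]; first exact: ratmx_const.
by apply: ratmx_eq (ratmxM rX IHs) => t _; rewrite mxpowS.
Qed.

Lemma ratmx_sum d (I : Type) (s : seq I) (Q : pred I) m n (X : I -> K -> 'M[K]_(m, n)) :
  (forall i, ratmx d (X i)) -> ratmx d (fun t => \sum_(i <- s | Q i) X i t).
Proof.
move=> rX i j; apply: (@ratfun_eq _ (fun t => \sum_(x <- s | Q x) X x t i j)) => [t _|].
  by rewrite summxE.
by apply: ratfun_sum => x; apply: rX.
Qed.

Lemma ratmx_line d m n (X Y : 'M[K]_(m, n)) : ratmx d (fun t => X + t *: Y).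
Proof.
by apply: ratmxD; [|apply: ratmxZ; first exact: ratfun_id]; apply: ratmx_const.
Qed.

Lemma ratfun_det d n (X : K -> 'M[K]_n) : ratmx d X -> ratfun d (fun t => \det (X t)).
Proof.
by move=> rX; apply: ratfun_sum => s; apply: ratfunM (ratfun_const _ _) (ratfun_prod _ _ _).
Qed.

Lemma ratmx_block d m1 m2 n1 n2 (X : K -> 'M[K]_(m1, n1)) (Y : K -> 'M[K]_(m1, n2))
    (Z : K -> 'M[K]_(m2, n1)) (T : K -> 'M[K]_(m2, n2)) :
  ratmx d X -> ratmx d Y -> ratmx d Z -> ratmx d T ->
  ratmx d (fun t => block_mx (X t) (Y t) (Z t) (T t)).
Proof.
move=> rX rY rZ rT i j; rewrite -[i]splitK -[j]splitK.
case: (split i) => i'; case: (split j) => j' /=.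
- by apply: ratfun_eq (rX i' j') => t _; rewrite block_mxEul.
- by apply: ratfun_eq (rY i' j') => t _; rewrite block_mxEur.
- by apply: ratfun_eq (rZ i' j') => t _; rewrite block_mxEdl.
- by apply: ratfun_eq (rT i' j') => t _; rewrite block_mxEdr.
Qed.

Lemma ratmx_inv d n (X : K -> 'M[K]_n) :
  ratmx d X -> (forall t, \det (X t) = d.[t]) -> ratmx d (fun t => invmx (X t)).
Proof.
move=> rX dX; apply: (@ratmx_eq _ _ _ (fun t => d.[t]^-1 *: \adj (X t))).
  by move=> t dt; rewrite /invmx unitmxE dX unitfE dt.
apply: ratmxZ (ratfun_inv _) _ => i j.
apply: (@ratfun_eq _ (fun t => cofactor (X t) j i)) => [t _|]; first by rewrite mxE.
apply: ratfunM (ratfun_const _ _) _; apply: ratfun_det => x y.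
by apply: ratfun_eq (rX (lift j x) (lift i y)) => t _; rewrite !mxE.
Qed.

(** Lower semicontinuity of the rank: L X(0) R is the identity of size rank X(0), so det (L X(t) R)
    is a nonzero polynomial, and X(t) has at least that rank where it does not vanish. *)
Lemma almost_rank n (X : K -> 'M[K]_n) :
  ratmx 1 X -> almost (fun t => (\rank (X 0)%R <= \rank (X t))%N).
Proof.
move=> rX; set r := \rank (X 0)%R.
pose L : 'M_(r, n) := pinvmx (col_base (X 0)); pose R := pinvmx (row_base (X 0)).
have LR : \det (L *m X 0 *m R) = 1.
  have -> : L *m X 0 = row_base (X 0).
    rewrite -[Y in L *m Y = _](mulmx_base (X 0)) mulmxA mulVpmx ?mul1mx //.
    exact: col_base_full.
  by rewrite mulmxVp ?row_base_free ?det1.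
have rat : ratfun 1 (fun t => \det (L *m X t *m R)).
  by apply: ratfun_det; apply: ratmxM (ratmxM _ rX) _; apply: ratmx_const.
have /(ratfun_almost rat) : \det (L *m X 0 *m R) != 0 by rewrite LR oner_eq0.
rewrite hornerC oner_eq0 => /(_ isT); apply: almost_imp => t [dt _].
have u : L *m X t *m R \in unitmx by rewrite unitmxE unitfE.
rewrite -[r](mxrank_unit u).
by apply: leq_trans (mxrankM_maxl _ _) (mxrankM_maxr _ _).
Qed.

End RationalCurves.

(** * Degenerations of homomorphisms *)

Section Closure.
Variable K : closedFieldType.

(* Polynomial functions are only used through their restrictions to lines, since
   all degenerations below move along lines. *)
Definition line_polynomial (V : lmodType K) (P : V -> K) :=
  forall z w, ratfun 1 (fun t => P (z + t *: w)).

(** The closure of [S] for the zero sets of functions that are polynomial along every line.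
    Polynomial functions are among these, so such points lie in the Zariski closure. *)
Definition zcl (V : lmodType K) (S : V -> Prop) z :=
  forall P, line_polynomial P -> (forall s, S s -> P s = 0) -> P z = 0.

(** A function that is nonzero at [z] stays nonzero at almost every point of a line through [z]. *)
Lemma zcl_line (V : lmodType K) (S : V -> Prop) z w :
  almost (fun t => zcl S (z + t *: w)) -> zcl S z.
Proof.
move=> aS P lP PS; apply/eqP; apply/negPn/negP => Pz.
have P0 : P (z + 0 *: w) != 0 by rewrite scale0r addr0.
have d0 : (1 : {poly K}).[0] != 0 by rewrite hornerC oner_eq0.
have [t [clt [/eqP[]]]] := almost_ex (almost_and aS (ratfun_almost (lP z w) d0 P0)).
exact: clt.
Qed.

Section Triples.
Variable m : nat.

Definition triple p q : lmodType K := ('M[K]_p * 'M[K]_q * 'M[K]_(p, q))%type.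

(* A on the source, B on the target (both acting on row vectors), and a
   homomorphism H from the source to the target. *)
Definition hom_triple p q (z : triple p q) : Prop :=
  [/\ z.1.1 ^+ m = 0, z.1.2 ^+ m = 0 & z.1.1 *m z.2 = z.2 *m z.1.2].

(** Each of these ranks can only grow at a general point of a line through [z], so their sum,
    bounded by m (p + q), can drive the induction. *)
Definition rank_sum p q (z : triple p q) : nat :=
  \sum_(s < m) (\rank (z.1.1 ^+ s) + \rank (z.1.2 ^+ s)).

Lemma rank_sum_le p q (z : triple p q) : (rank_sum z <= m * (p + q))%N.
Proof.
apply: (@leq_trans (\sum_(s < m) (p + q))%N).
  by apply: leq_sum => s _; rewrite leq_add ?rank_leq_row.
by rewrite sum_nat_const card_ord.
Qed.

(** By semicontinuity no other rank drops, so a strict jump of a single power is enough. *)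
Lemma rank_sum_line p q (A A1 : 'M[K]_p) (B B1 : 'M[K]_q) (H H1 : 'M[K]_(p, q)) j :
  (j < m)%N ->
  almost (fun t => (\rank (B ^+ j)%R < \rank ((B + t *: B1) ^+ j)%R)%N) ->
  almost (fun t => (rank_sum ((A, B, H) : triple p q) <
                    rank_sum ((A, B, H) + t *: (A1, B1, H1) : triple p q))%N).
Proof.
move=> jm aj.
have aA s : (s < m)%N -> almost (fun t => (\rank (A ^+ s)%R <= \rank ((A + t *: A1) ^+ s)%R)%N).
  by move=> _; have := almost_rank (ratmxX s (ratmx_line 1 A A1)); rewrite scale0r addr0.
have aB s : (s < m)%N -> almost (fun t => (\rank (B ^+ s)%R <= \rank ((B + t *: B1) ^+ s)%R)%N).
  by move=> _; have := almost_rank (ratmxX s (ratmx_line 1 B B1)); rewrite scale0r addr0.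
apply: almost_imp (almost_and aj (almost_and (almost_all aA) (almost_all aB))).
move=> t [rj [rA rB]]; rewrite /rank_sum /=.
rewrite (bigD1 (Ordinal jm)) // [ltnRHS](bigD1 (Ordinal jm)) //= -addSn.
apply: leq_add; first by rewrite -addnS leq_add // rA.
by apply: leq_sum => s _; rewrite leq_add ?rA ?rB.
Qed.

(** Both sides are the convolution sum of E(u) G(r+l-1-u) over u < r + l: the left drops u < r,
    where [G] vanishes, and the right drops u >= i, where [E] vanishes. *)
Lemma sum_shift (G E : nat -> K) (i l r : nat) : (i <= l)%N ->
  (forall s, (l <= s)%N -> G s = 0) -> (forall s, (i <= s)%N -> E s = 0) ->
  \sum_(b < l) G (l - b.+1)%N * E (r + b)%N =
  \sum_(a < i) E (i - a.+1)%N * G (r + (l - i + a))%N.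
Proof.
move=> il G0 E0; pose F u := E u * G (r + l - u.+1)%N.
transitivity (\sum_(0 <= u < r + l) F u).
  rewrite (@big_cat_nat _ _ _ r) ?leq_addr //= [X in _ = X + _]big_nat.
  rewrite [X in _ = X + _]big1 => [|u ur].
    rewrite add0r -[X in \sum_(X <= _ < _) _]add0n big_addn addKn big_mkord; apply: eq_bigr => b _.
    rewrite mulrC /F addnC; congr (_ * G _); have := ltn_ord b; lia.
  by rewrite /F G0 ?mulr0 //; lia.
rewrite (@big_cat_nat _ _ _ i) //=; last lia.
rewrite [X in _ + X = _]big_nat [X in _ + X = _]big1 => [|u iu].
  rewrite addr0 big_mkord (reindex_inj rev_ord_inj); apply: eq_bigr => a _ /=.
  by rewrite /F; congr (_ * G _); have := ltn_ord a; lia.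
by rewrite /F E0 ?mul0r //; lia.
Qed.

(** * Simultaneous perturbation of source and target *)

Section DeformBoth.
Variables (p q i j l : nat) (A : 'M[K]_p) (B : 'M[K]_q) (H : 'M[K]_(p, q)).
Variables (a : 'rV[K]_p) (g : 'rV[K]_q) (e' g' : 'cV[K]_q).
Hypotheses (i0 : (0 < i)%N) (il : (i <= l)%N) (lj : (l <= j)%N) (jm : (j < m)%N).
Hypotheses (aA : a *m A ^+ l = 0) (gB : g *m B ^+ j = 0).
Hypotheses (Be : B ^+ i *m e' = 0) (Bg : B ^+ j *m g' = 0).
Hypotheses (ge : forall s, g *m B ^+ s *m e' = 0).
Hypotheses (gg : forall s, g *m B ^+ s *m g' = (s.+1 == j)%:R%:M).
Hypothesis homsH : hom_triple ((A, B, H) : triple p q).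
Let y := a *m H.
Hypotheses (yg : y *m B ^+ l.-1 *m g' != 0) (ye : y *m B ^+ i.-1 *m e' != 0).

Let G s := (y *m B ^+ s *m g') 0 0.
Let E s := (y *m B ^+ s *m e') 0 0.
Let L := (i + j - l)%N.

(* phi is orthogonal to the orbit of y, so that perturbing A and B by rank one
   matrices built from phi and a keeps both nilpotent of order m. *)
Let phi : 'cV[K]_q := \sum_(b < l) G (l - b.+1) *: (B ^+ b *m e') -
  \sum_(b < i) E (i - b.+1) *: (B ^+ (l - i + b) *m g').

Let AH s : A ^+ s *m H = H *m B ^+ s.
Proof. by have [_ _ AH] := homsH; apply: mxpow_comm. Qed.

Let yB : y *m B ^+ l = 0.
Proof. by rewrite -mulmxA -AH mulmxA aA mul0mx. Qed.

(** The two halves of [phi] contribute the two sides of [sum_shift]. *)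
Let y_phi r : y *m B ^+ r *m phi = 0.
Proof.
rewrite mulmxBr !mulmx_sumr.
under eq_bigr => b _ do
  rewrite -scalemxAr mulmxA -(mulmxA y) -mxpowD [_ *m e']mx11_scalar -/(E _) scale_scalar_mx.
under [X in _ - X]eq_bigr => b _ do
  rewrite -scalemxAr mulmxA -(mulmxA y) -mxpowD [_ *m g']mx11_scalar -/(G _) scale_scalar_mx.
rewrite -!raddf_sum -raddfB (@sum_shift G E i l r) ?subrr ?raddf0 // => s sl.
  by rewrite /G (row_pow_eq0 yB) // mul0mx mxE.
by rewrite /E -mulmxA (col_pow_eq0 Be) // mulmx0 mxE.
Qed.

(** The part with e' dies because L >= i, and the part with g' because L + (l - i) = j. *)
Let B_phi : B ^+ L *m phi = 0.
Proof.
rewrite mulmxBr !mulmx_sumr !big1 ?subrr // => b _.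
  by rewrite -scalemxAr mulmxA -mxpowD (col_pow_eq0 Bg) ?scaler0 // /L; lia.
by rewrite -scalemxAr mulmxA -mxpowD (col_pow_eq0 Be) ?scaler0 // /L; lia.
Qed.

(** Since L - 1 + (l - i) = j - 1, [g] sees only the term b = 0 of the second sum, whose coefficient
    E(i-1) is nonzero. *)
Let g_phi : g *m (B ^+ L.-1 *m phi) != 0.
Proof.
suff -> : g *m (B ^+ L.-1 *m phi) = - (y *m B ^+ i.-1 *m e') by rewrite oppr_eq0.
rewrite mulmxA mulmxBr !mulmx_sumr big1 => [|b _]; last first.
  by rewrite -scalemxAr mulmxA -(mulmxA g) -mxpowD ge scaler0.
rewrite sub0r (bigD1 (Ordinal i0)) //= big1 => [|b b0].
  rewrite addr0 -scalemxAr mulmxA -(mulmxA g) -mxpowD gg subn1 scale_scalar_mx.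
  rewrite (_ : (_ == _) = true) ?mulr1 -?mx11_scalar //.
  by apply/eqP; rewrite /L; lia.
rewrite -scalemxAr mulmxA -(mulmxA g) -mxpowD gg.
rewrite (_ : (_ == _) = false) ?raddf0 ?scaler0 //; apply/negbTE.
by have : (b : nat) != 0%N by []; rewrite /L; lia.
Qed.

(** For t nonzero the j-th power of [B] gains t B^(L-1) phi y B^(l-1), which is detected by [g] on
    the left and g' on the right, both killed by B^j. The m-th powers stay zero because j < m, and A
    H = H B is preserved for every t. *)
Lemma zcl_deform_both (S : triple p q -> Prop) :
  (forall z, hom_triple z ->
     (rank_sum ((A, B, H) : triple p q) < rank_sum z)%N -> zcl S z) ->
  zcl S ((A, B, H) : triple p q).
Proof.
move=> clS; pose w := a *m A ^+ i.-1.
have wH : w *m H = y *m B ^+ i.-1 by rewrite -mulmxA AH mulmxA.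
have [Am Bm /= AHB] := homsH.
have wA r : w *m A ^+ r *m (H *m phi) = 0.
  by rewrite /w -(mulmxA a) -mxpowD mulmxA -(mulmxA a) AH mulmxA y_phi.
have wB r : (w *m H) *m B ^+ r *m phi = 0.
  by rewrite wH -(mulmxA y) -mxpowD y_phi.
have lL : (l + L = i + j)%N by rewrite /L; lia.
apply: (zcl_line (w := ((H *m phi) *m w, phi *m (w *m H), 0))).
have rank_sum_gt := @rank_sum_line p q A ((H *m phi) *m w) B (phi *m (w *m H)) H 0 j jm.
apply: almost_imp (rank_sum_gt _) => [t|]; last first.
  apply: almost_imp (almost_neq 0) => t t0; rewrite pow_perturb // wH.
  rewrite (dpow_last (l := l) (L := L)) //; try by rewrite /L; lia.
  rewrite -mulmxA; apply: (@rank_perturb _ _ _ _ g' _ g) => //.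
apply: clS; split => /=.
- rewrite pow_perturb // Am (dpow_eq0 (j := j) (l := l) (L := L)) ?lL //.
    by rewrite scaler0 addr0.
  by rewrite mulmxA AH -mulmxA B_phi mulmx0.
- rewrite wH pow_perturb -?wH // Bm wH (dpow_eq0 (j := j) (l := l) (L := L)) ?lL //.
  by rewrite scaler0 addr0.
- rewrite scaler0 addr0 mulmxDl [RHS]mulmxDr AHB -scalemxAl -scalemxAr.
  by rewrite !mulmxA.
Qed.

End DeformBoth.

End Triples.
End Closure.

(** * Degeneration steps and density of the generic triples *)

Section Degeneration.
Variables (K : closedFieldType) (m : nat).
Hypothesis m0 : (0 < m)%N.

(** * Perturbation of the target alone *)

Section DeformTarget.
Variables (p q i j : nat) (A : 'M[K]_p) (B : 'M[K]_q) (H : 'M[K]_(p, q)).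
Variables (I : finType) (l : I -> nat) (a : I -> 'rV[K]_p) (c : I -> 'cV[K]_p).
Variables (e g : 'rV[K]_q) (e' g' : 'cV[K]_q).
Hypotheses (i0 : (0 < i)%N) (ij : (i <= j)%N) (jm : (j < m)%N).
Hypotheses (sA : jordan_system A l a c) (l0 : forall k, (0 < l k)%N).
Hypothesis lij : forall k, (l k < i)%N || (j < l k)%N.
Hypotheses (eB : e *m B ^+ i = 0) (gB : g *m B ^+ j = 0).
Hypotheses (Be : B ^+ i *m e' = 0) (Bg : B ^+ j *m g' = 0).
Hypotheses (eg : forall s, e *m B ^+ s *m g' = 0).
Hypotheses (gg : forall s, g *m B ^+ s *m g' = (s.+1 == j)%:R%:M).
Hypotheses (ee : forall s, e *m B ^+ s *m e' = (s.+1 == i)%:R%:M).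
Hypothesis homsH : hom_triple m ((A, B, H) : triple K p q).

Let w := e *m B ^+ i.-1.

Let w_g r : w *m B ^+ r *m g' = 0.
Proof. by rewrite -(mulmxA e) -mxpowD eg. Qed.

Let dpow_w s : dpow B g' w s.+1 = B ^+ s *m g' *m w.
Proof.
rewrite dpowS -[RHS]add0r; congr (_ + _); rewrite mulmx_suml big1 // => r _.
rewrite -!mulmxA -mxpowSr -mxpowD (row_pow_eq0 eB) ?mulmx0 //; lia.
Qed.

(** The value of [H1] at the generator a_k, chosen so that [rho k] ends at zero. If l_k > j the
    [dpow] part vanishes by itself; if l_k < i it ends at (a_k H B^(l_k-1) g') w, which y'_k B^(l_k)
    cancels because w = e B^(i-1). *)
Let y' k : 'rV[K]_q :=
  if (l k < i)%N then - (a k *m H *m B ^+ (l k).-1 *m g') *m (e *m B ^+ (i.-1 - l k))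
  else 0.

(** The intended image of a_k A^s under [H1]. *)
Let rho k s := a k *m H *m dpow B g' w s + y' k *m B ^+ s.

Let rho_last k : rho k (l k) = 0.
Proof.
rewrite /rho /y'; case: ifP => [li|]; last first.
  have /orP[->//|jl _] := lij k.
  by rewrite (@dpow_eq0 _ _ B g' e i j i j) // mulmx0 mul0mx addr0.
rewrite -{2}(prednK (l0 k)) -[in X in dpow _ _ _ X](prednK (l0 k)) dpow_w /w.
rewrite !mulNmx -!mulmxA -mxpowD subnK ?subrr //; last lia.
Qed.

Let H1 := \sum_k \sum_(s < l k) A ^+ (l k - s.+1) *m c k *m rho k s.

Let AH s : A ^+ s *m H = H *m B ^+ s.
Proof. by have [_ _ AH] := homsH; apply: mxpow_comm. Qed.

(** Each string contributes the inhomogeneous term a_k A^s H g' w, and completeness of the Jordan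
    system of [A] reassembles these into H g' w. *)
Let A_H1 : A *m H1 = H1 *m B + H *m g' *m w.
Proof.
have [[_ Ac _] s1] := sA; rewrite mulmx_sumr mulmx_suml.
rewrite -[in RHS](mul1mx (H *m g' *m w)) -s1 mulmx_suml -big_split /=.
apply: eq_bigr => k _; have := @string_sum_intertwine _ _ _ A B (l k) (c k) (rho k)
  (fun s => a k *m A ^+ s *m (H *m g' *m w)) (Ac k) (rho_last k).
move=> ->.
  by congr (_ + _); rewrite mulmx_suml; apply: eq_bigr => s _; rewrite -!mulmxA.
move=> s _; rewrite /rho dpowS mxpowSr mulmxDr mulmxDl.
rewrite !mulmxA -[a k *m A ^+ s *m H]mulmxA AH !mulmxA.
by rewrite -!addrA [X in _ + X = _]addrC.
Qed.

(** This removes the term of order t^2 in (H + t H1) (B + t g' w). *)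
Let H1_g : H1 *m g' = 0.
Proof.
rewrite mulmx_suml big1 // => k _; rewrite mulmx_suml big1 // => s _.
rewrite -mulmxA mulmxDl -(mulmxA _ (dpow _ _ _ _)) dpow_kill // mulmx0 add0r.
rewrite /y'; case: ifP => _; last by rewrite !mul0mx mulmx0.
by rewrite -!mulmxA (mulmxA (B ^+ _) (B ^+ s)) -mxpowD (mulmxA e) eg !mulmx0.
Qed.

(** The j-th power of [B] gains t B^(j-1) g' e B^(i-1), whose pairing with [g] and e' is t, whereas
    B^j is killed by both; hence its rank jumps. *)
Lemma zcl_deform_target (S : triple K p q -> Prop) :
  (forall z, hom_triple m z ->
     (rank_sum m ((A, B, H) : triple K p q) < rank_sum m z)%N -> zcl S z) ->
  zcl S ((A, B, H) : triple K p q).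
Proof.
move=> clS; have [Am Bm /= AHB] := homsH.
apply: (zcl_line (w := (0, g' *m w, H1))).
have rank_sum_gt := @rank_sum_line K m p q A 0 B (g' *m w) H H1 j jm.
apply: almost_imp (rank_sum_gt _) => [t|]; last first.
  apply: almost_imp (almost_neq 0) => t t0; rewrite pow_perturb //.
  rewrite (@dpow_last _ _ B g' e i j i j) ?(leq_trans i0 ij) // -mulmxA.
  apply: (@rank_perturb _ _ _ _ e' _ g) => //.
  - exact: col_pow_eq0 Be ij.
  - rewrite mulmxA gg prednK ?eqxx; last exact: leq_trans i0 ij.
    by apply/eqP=> /matrixP/(_ 0 0)/eqP; rewrite !mxE oner_eq0.
  - rewrite ee prednK // eqxx.
    by apply/eqP=> /matrixP/(_ 0 0)/eqP; rewrite !mxE oner_eq0.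
apply: clS; split => /=.
- by rewrite scaler0 addr0.
- by rewrite pow_perturb // Bm (@dpow_eq0 _ _ B g' e i j i j) // scaler0 addr0.
- rewrite scaler0 addr0 mulmxDr mulmxDl !mulmxDr AHB -!scalemxAr -!scalemxAl A_H1.
  rewrite (mulmxA H1) H1_g mul0mx !scaler0 addr0 scalerDr -(mulmxA H) -!addrA.
  by congr (_ + _); exact: addrC.
Qed.

End DeformTarget.

Lemma zcl_block_pair p q (A : 'M[K]_p) (B : 'M[K]_q) (H : 'M[K]_(p, q))
    (I J : finType) (l : I -> nat) a c (l' : J -> nat) b d (k k' : J)
    (S : triple K p q -> Prop) :
  jordan_system A l a c -> (forall x, 0 < l x)%N -> jordan_system B l' b d -> (0 < l' k)%N ->
  k != k' -> (l' k <= l' k')%N -> (l' k' < m)%N ->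
  hom_triple m ((A, B, H) : triple K p q) ->
  (forall z, hom_triple m z ->
     (rank_sum m ((A, B, H) : triple K p q) < rank_sum m z)%N -> zcl S z) ->
  zcl S ((A, B, H) : triple K p q).
Proof.
move=> sA l0 [[bB Bd bd] _] lk0 kk' lkk' lkm hH clS.
have kk'F : (k == k') = false by apply/negbTE.
have k'kF : (k' == k) = false by rewrite eq_sym.
have eg s : b k *m B ^+ s *m d k' = 0 by rewrite bd kk'F raddf0.
have ge s : b k' *m B ^+ s *m d k = 0 by rewrite bd k'kF raddf0.
have ee s : b k *m B ^+ s *m d k = (s.+1 == l' k)%:R%:M by rewrite bd eqxx.
have gg s : b k' *m B ^+ s *m d k' = (s.+1 == l' k')%:R%:M by rewrite bd eqxx.
have [/existsP[x /andP[kx xk']]|/existsPn nx] :=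
    boolP [exists x, (l' k <= l x)%N && (l x <= l' k')%N]; last first.
  apply: (zcl_deform_target lk0 lkk' lkm sA l0 _ (bB k) (bB k') (Bd k) (Bd k') eg gg ee hH clS).
  by move=> x; have := nx x; rewrite negb_and -!ltnNge.
have [[aA Ac ac] _] := sA; have [Am Bm /= AHB] := hH.
(* This vector is killed by B^(l x) and pairs to 1 with both dual generators at the powers that
   matter. Adding a multiple of the homomorphism a_x -> u to [H] therefore makes both pairings
   required by [zcl_deform_both] nonzero. *)
pose u := b k + b k' *m B ^+ (l' k' - l x).
have uB : u *m B ^+ l x = 0.
  by rewrite mulmxDl (row_pow_eq0 (bB k)) // add0r -mulmxA -mxpowD subnK.
pose H1 := string_map A B (l x) (c x) u.
have AH1 : A *m H1 = H1 *m B by apply: string_map_hom.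
have aH1 : a x *m H1 = u.
  by apply: string_map_eval => // s; rewrite ac eqxx.
have y_line s (r : 'cV_q) t : (a x *m (H + t *: H1) *m B ^+ s *m r) 0 0 =
    (a x *m H *m B ^+ s *m r) 0 0 + t * (u *m B ^+ s *m r) 0 0.
  by rewrite mulmxDr -scalemxAr aH1 mulmxDl mulmxDl -!scalemxAl [LHS]mxE [X in _ + X]mxE.
have ug : (u *m B ^+ (l x).-1 *m d k') 0 0 = 1.
  rewrite mulmxDl -mulmxA -mxpowD mulmxDl eg gg add0r.
  rewrite (_ : (_ == _) = true) ?mxE //; apply/eqP; have := l0 x; lia.
have ue : (u *m B ^+ (l' k).-1 *m d k) 0 0 = 1.
  rewrite mulmxDl -mulmxA -mxpowD mulmxDl ee ge addr0.
  by rewrite prednK // eqxx mxE.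
(* Only [H] moves here, so the rank sum stays the same and [clS] applies at every point of the
   line. *)
apply: (zcl_line (w := (0, 0, H1) : triple K p q)).
pose G0 := (a x *m H *m B ^+ (l x).-1 *m d k') 0 0.
pose E0 := (a x *m H *m B ^+ (l' k).-1 *m d k) 0 0.
apply: almost_imp (almost_and (almost_neq (- G0)) (almost_neq (- E0))) => t [tG tE].
have -> : (A, B, H) + t *: (0, 0, H1) = (A, B, H + t *: H1) :> triple K p q.
  by congr (_, _, _); rewrite /= scaler0 addr0.
apply: (@zcl_deform_both K m p q (l' k) (l' k') (l x) A B _ (a x) (b k') (d k) (d k')) => //.
- split=> //=; rewrite mulmxDr mulmxDl AHB.
  by rewrite -scalemxAr -scalemxAl AH1.
- apply: contraNneq tG => /matrixP/(_ 0 0); rewrite y_line ug mulr1 [X in _ = X]mxE => /eqP.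
  by rewrite addrC addr_eq0.
- apply: contraNneq tE => /matrixP/(_ 0 0); rewrite y_line ue mulr1 [X in _ = X]mxE => /eqP.
  by rewrite addrC addr_eq0.
Qed.

(** Transposing A H = H B exchanges the roles of source and target. *)
Definition tr_triple p q (z : triple K p q) : triple K q p :=
  (z.1.2^T, z.1.1^T, z.2^T).

Lemma tr_tripleK p q (z : triple K p q) : tr_triple (tr_triple z) = z.
Proof. by case: z => [[A B] H]; rewrite /tr_triple /= !trmxK. Qed.

Lemma tr_triple_zcl p q (S : triple K p q -> Prop) z :
  zcl (fun x => S (tr_triple x)) (tr_triple z) -> zcl S z.
Proof.
move=> clz P lP PS; rewrite -(tr_tripleK z).
apply: (clz (fun x => P (tr_triple x))) => [x w|x Sx]; last exact: PS.
apply: (ratfun_eq _ (lP (tr_triple x) (tr_triple w))) => t _; congr (P _).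
by rewrite /tr_triple /=; congr (_, _, _); rewrite /= linearD linearZ.
Qed.

Lemma tr_triple_homs p q (z : triple K p q) : hom_triple m z -> hom_triple m (tr_triple z).
Proof.
move=> [Am Bm AH]; split=> /=; rewrite -?trmx_pow ?Am ?Bm ?trmx0 //.
by rewrite -!trmx_mul AH.
Qed.

Lemma tr_triple_pot p q (z : triple K p q) : rank_sum m (tr_triple z) = rank_sum m z.
Proof. by apply: eq_bigr => s _ /=; rewrite -!trmx_pow !mxrank_tr addnC. Qed.

Definition generic_triple p q (z : triple K p q) : Prop :=
  [/\ hom_triple m z, generic m z.1.1 & generic m z.1.2].

Theorem generic_triple_dense p q (z : triple K p q) :
  hom_triple m z -> zcl (@generic_triple p q) z.
Proof.
(* The rank sum grows and is bounded by m (p + q), so the induction is on its distance from that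
   bound. *)
have [n le] := ubnP (m * (p + q) - rank_sum m z); elim: n => // n IHn in p q z le *.
move=> hz; case: z hz le => [[A B] H] hH le; have [Am Bm /= AHB] := hH.
have IH z : hom_triple m z -> (rank_sum m ((A, B, H) : triple K p q) < rank_sum m z)%N ->
    zcl (@generic_triple p q) z.
  move=> hz lt; apply: IHn => //.
  exact: leq_trans (ltn_sub2l (leq_trans lt (rank_sum_le m z)) lt) le.
have [||I [l [a [c [l0 _ _ oA sA]]]]] := @jordan_system_exists K p A m Am 1%:M.
- by rewrite mul1mx.
- by rewrite mul1mx mulmx1.
have [||J [l' [b [d [l0' _ _ oB sB]]]]] := @jordan_system_exists K q B m Bm 1%:M.
- by rewrite mul1mx.
- by rewrite mul1mx mulmx1.
have jA : jordan_system A l a c by []. have jB : jordan_system B l' b d by [].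
have [gB|[k [k' [kk' le_kk' ltm]]]] := generic_or_pair jB Bm m0 l0'; last first.
  by apply: (zcl_block_pair jA l0 jB (l0' k) kk').
have [gA|[k [k' [kk' le_kk' ltm]]]] := generic_or_pair jA Am m0 l0; last first.
  apply: tr_triple_zcl.
  apply: (zcl_block_pair (jordan_system_tr jB) l0' (jordan_system_tr jA) (l0 k) kk') => //.
    exact: (tr_triple_homs hH).
  move=> z hz lt.
  apply: tr_triple_zcl => P lP PS; apply: (IH (tr_triple z) _ _ P lP); first exact: tr_triple_homs.
    by rewrite tr_triple_pot -(tr_triple_pot ((A, B, H) : triple K p q)).
  move=> s Ss.
  by apply: PS; rewrite tr_tripleK.
by move=> P lP; apply.
Qed.

End Degeneration.

(** * Modules over A(m,1) *)

Section TruncatedEvaluation.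
Variables (K : fieldType) (m n : nat).
Hypothesis m0 : (0 < m)%N.
Implicit Types (A : 'M[K]_n) (r s : {poly K}).

(** This is r(A) when A^m = 0; cutting the sum at m makes X^m act as zero for every [A]. *)
Definition trunc_ev A r : 'M[K]_n := \sum_(i < m) r`_i *: A ^+ i.

Lemma trunc_ev_is_linear A : linear (trunc_ev A).
Proof.
move=> k r s; rewrite /trunc_ev scaler_sumr -big_split; apply: eq_bigr => i _.
by rewrite coefD coefZ scalerDl scalerA.
Qed.
HB.instance Definition _ A :=
  GRing.isLinear.Build K {poly K} 'M[K]_n _ (trunc_ev A) (trunc_ev_is_linear A).

Lemma trunc_evC A k : trunc_ev A k%:P = k%:M.
Proof.
rewrite /trunc_ev (bigD1 (Ordinal m0)) //= coefC eqxx expr0 big1 => [|i i0].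
  by rewrite addr0 scalemx1.
by rewrite coefC (_ : (i == 0%N :> nat) = false) ?scale0r //; apply/negbTE.
Qed.

Lemma trunc_evMX A r : A ^+ m = 0 -> trunc_ev A (r * 'X) = trunc_ev A r *m A.
Proof.
move=> Am; rewrite /trunc_ev mulmx_suml; case: m m0 Am => // m' _ Am.
rewrite big_ord_recl [RHS]big_ord_recr /= coefMX eqxx scale0r add0r.
rewrite -scalemxAl -mxpowSr Am scaler0 addr0; apply: eq_bigr => i _.
by rewrite coefMX /= -scalemxAl -mxpowSr.
Qed.

Lemma trunc_evM A r s : A ^+ m = 0 -> trunc_ev A (r * s) = trunc_ev A r *m trunc_ev A s.
Proof.
move=> Am; elim/poly_ind: s => [|s k IHs]; first by rewrite mulr0 !linear0.
rewrite mulrDr mulrA !linearD /= !trunc_evMX // IHs [in RHS]mulmxA trunc_evC.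
by rewrite mul_mx_scalar mulrC mul_polyC linearZ.
Qed.

Lemma trunc_evX A : A ^+ m = 0 -> trunc_ev A 'X = A.
Proof. by move=> Am; rewrite -['X]mul1r trunc_evMX // -polyC1 trunc_evC mul1mx. Qed.

Lemma trunc_evXm A : trunc_ev A 'X^m = 0.
Proof.
by apply: big1 => i _; rewrite coefXn (ltn_eqF (ltn_ord i)) scale0r.
Qed.

Lemma trunc_ev_mod A r : A ^+ m = 0 -> trunc_ev A (Pdiv.CommonRing.rmodp r 'X^m) = trunc_ev A r.
Proof.
move=> Am; rewrite [in RHS](Pdiv.RingMonic.rdivp_eq (monicXn K m) r) linearD /=.
by rewrite trunc_evM // trunc_evXm mulmx0 add0r.
Qed.

End TruncatedEvaluation.

Lemma trunc_ev_intertwine (K : fieldType) m n n' (A : 'M[K]_n) (A' : 'M[K]_n') g r :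
  A *m g = g *m A' -> trunc_ev m A r *m g = g *m trunc_ev m A' r.
Proof.
move=> Ag; rewrite mulmx_suml mulmx_sumr; apply: eq_bigr => i _.
by rewrite -scalemxAl -scalemxAr (mxpow_comm i Ag).
Qed.

Section AlgebraModules.
Variables (K : closedFieldType) (m : nat).
Hypothesis m0 : (0 < m)%N.

Local Notation Lam := (Lambda K m).
Local Notation LX := (LambdaX K m).
Local Notation T := (tensor_bimodule Lam Lam).

Definition Lambda_val (u : Lam) : {poly K} := (u : {poly %/ ('X^m : {poly K})}).

Definition Lambda_ev n (A : 'M[K]_n) (u : Lam) : 'M[K]_n := trunc_ev m A (Lambda_val u).

Lemma Lambda_ev_is_linear n (A : 'M[K]_n) : linear (Lambda_ev A).
Proof. by move=> k u v; rewrite -linearP. Qed.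
HB.instance Definition _ n (A : 'M[K]_n) :=
  GRing.isLinear.Build K Lam 'M[K]_n _ (Lambda_ev A) (Lambda_ev_is_linear A).

(** The modulus is kept because m > 0; for m = 0 it would be replaced by X. *)
Lemma mk_monicXm : mk_monic ('X^m : {poly K}) = 'X^m.
Proof. by rewrite mk_monic_Xn prednK. Qed.

Lemma Lambda_val_in_qpoly r : Lambda_val (in_qpoly 'X^m r) = Pdiv.CommonRing.rmodp r 'X^m.
Proof. by congr (Pdiv.CommonRing.rmodp _ _); apply: mk_monicXm. Qed.

Lemma Lambda_valM (u v : Lam) :
  Lambda_val (u * v) = Pdiv.CommonRing.rmodp (Lambda_val u * Lambda_val v) 'X^m.
Proof. by rewrite -Lambda_val_in_qpoly. Qed.

Lemma Lambda_evM n (A : 'M[K]_n) (u v : Lam) : A ^+ m = 0 ->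
  Lambda_ev A (u * v) = Lambda_ev A u *m Lambda_ev A v.
Proof. by move=> Am; rewrite /Lambda_ev Lambda_valM trunc_ev_mod // trunc_evM. Qed.

Lemma Lambda_ev1 n (A : 'M[K]_n) : Lambda_ev A 1 = 1%:M.
Proof. by rewrite /Lambda_ev /= -[RHS](trunc_evC m0 A). Qed.

Lemma Lambda_evX n (A : 'M[K]_n) : A ^+ m = 0 -> Lambda_ev A LX = A.
Proof. by move=> Am; rewrite /Lambda_ev Lambda_val_in_qpoly trunc_ev_mod // trunc_evX. Qed.

Lemma in_qpolyX i : in_qpoly 'X^m 'X^i = LX ^+ i.
Proof. exact: rmorphXn. Qed.

Lemma Lambda_nilpotent : LX ^+ m = 0.
Proof.
rewrite -in_qpolyX; apply: val_inj; rewrite -[LHS]/(Lambda_val _) Lambda_val_in_qpoly.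
exact: Pdiv.RingMonic.rmodpp (monicXn K m).
Qed.

Lemma Lambda_span (u : Lam) : u = \sum_(i < m) (Lambda_val u)`_i *: LX ^+ i.
Proof.
have su : (size (Lambda_val u) <= m)%N.
  by rewrite -ltnS (leq_trans (size_mk_monic _)) // mk_monicXm size_polyXn.
transitivity (in_qpoly 'X^m (\sum_(i < m) (Lambda_val u)`_i *: 'X^i)).
  apply: val_inj; rewrite -[RHS]/(Lambda_val _) Lambda_val_in_qpoly.
  rewrite -poly_def (_ : \poly_(i < m) _ = Lambda_val u).
    by rewrite Pdiv.CommonRing.rmodp_small // size_polyXn ltnS.
  apply/polyP=> j; rewrite coef_poly; case: ltnP => // mj.
  by rewrite nth_default // (leq_trans su).
by rewrite linear_sum; apply: eq_bigr => i _; rewrite linearZ /= in_qpolyX.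
Qed.

Definition Gamma_rel : T := tens (1 : Lam) LX + tens LX (1 : Lam).

Local Notation Gam := (Gamma K m).

Definition Gamma_pi (t : T) : Gam := quotv_pi (gen_bimod Gamma_rel) t.

Lemma Gamma_pi_surj (x : Gam) : exists t, x = Gamma_pi t.
Proof. by exists (quotv_repr _ x); rewrite /Gamma_pi quotv_reprK. Qed.

Definition Gamma_l (b : Lam) (x : Gam) : Gam := lact Gam b x.
Definition Gamma_r (b : Lam) (x : Gam) : Gam := ract Gam b x.
(** It generates [Gamma] as a bimodule, see [Gamma_pi_tens], so its image determines the action of
    all of [Gamma]. *)
Definition Gamma_gen : Gam := Gamma_pi (tens (1 : Lam) (1 : Lam)).

Lemma Gamma_l_pi b t : Gamma_l b (Gamma_pi t) = Gamma_pi (lact T b t).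
Proof. exact: quot_lactE. Qed.

Lemma Gamma_r_pi b t : Gamma_r b (Gamma_pi t) = Gamma_pi (ract T b t).
Proof. exact: quot_ractE. Qed.

Lemma Gamma_l_tens b (u v : Lam) : Gamma_l b (Gamma_pi (tens u v)) = Gamma_pi (tens (b * u) v).
Proof. exact: etrans (Gamma_l_pi _ _) (congr1 Gamma_pi (tensor_lactE _ _ _)). Qed.

Lemma Gamma_r_tens b (u v : Lam) : Gamma_r b (Gamma_pi (tens u v)) = Gamma_pi (tens u (v * b)).
Proof. exact: etrans (Gamma_r_pi _ _) (congr1 Gamma_pi (tensor_ractE _ _ _)). Qed.

Lemma Gamma_pi_tens u v : Gamma_pi (tens u v) = Gamma_l u (Gamma_r v Gamma_gen).
Proof. by rewrite /Gamma_gen Gamma_r_tens Gamma_l_tens mulr1 mul1r. Qed.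

Lemma Gamma_pi_rel : Gamma_pi Gamma_rel = 0.
Proof.
have := gen_bimodE (Gamma_rel : T) 1 1; rewrite lact1 ract1 => rel.
by apply/eqP; rewrite /Gamma_pi quotv_pi_eq0.
Qed.

Lemma Gamma_piD s t : Gamma_pi (s + t) = Gamma_pi s + Gamma_pi t.
Proof. exact: linearD. Qed.

Lemma Gamma_gen_anticomm : Gamma_l LX Gamma_gen = - Gamma_r LX Gamma_gen.
Proof.
rewrite /Gamma_gen Gamma_l_tens Gamma_r_tens mulr1 mul1r.
apply: (addrI (Gamma_pi (tens 1 LX))); rewrite subrr -Gamma_piD; exact: Gamma_pi_rel.
Qed.

Lemma tens_eq (U V W : vectType K) (f g : tensor U V -> W) :
  linear f -> linear g -> (forall u v, f (tens u v) = g (tens u v)) -> f =1 g.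
Proof.
move=> lf lg fg t.
pose F : {linear tensor U V -> W} := HB.pack f (GRing.isLinear.Build K _ _ _ f lf).
pose G : {linear tensor U V -> W} := HB.pack g (GRing.isLinear.Build K _ _ _ g lg).
rewrite -[LHS]/(F t) -[RHS]/(G t) (tens_basis t) !linear_sum.
apply: eq_bigr => i _; rewrite !linear_sum; apply: eq_bigr => j _.
by rewrite !linearZ /= fg.
Qed.

Section FromTriple.
Variables (p q : nat) (z : triple K p q).
Local Notation A := z.1.1.
Local Notation B := z.1.2.
Local Notation H := z.2.

(* X in the lower right corner acts by -B, since X anticommutes with the
   generator of Gamma. *)
Definition tensor_lift (t : tensor Lam Lam) : 'M[K]_(p, q) :=
  tens_lift (fun u v => Lambda_ev A u *m H *m Lambda_ev (- B) v : 'M[K]_(p, q)) t.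

Lemma tensor_lift_is_linear : linear tensor_lift.
Proof. exact: tens_lift_is_linear. Qed.
HB.instance Definition _ :=
  GRing.isLinear.Build K (tensor Lam Lam) 'M[K]_(p, q) _ tensor_lift tensor_lift_is_linear.

(** Evaluating on a chosen representative makes this defined, and polynomial in [z], for all
    triples. For [hom_triple] it does not depend on the representative, by [Gamma_lift_pi]. *)
Definition Gamma_lift (x : Gam) : 'M[K]_(p, q) := tensor_lift (quotv_repr _ x).

Definition triple_rep (w : Am1 K m) : 'M[K]_(p + q) :=
  block_mx (Lambda_ev A w.1.1) (Gamma_lift w.1.2) 0 (Lambda_ev (- B) w.2).

Lemma triple_rep_is_linear : linear triple_rep.
Proof.
move=> k w w'; rewrite /triple_rep scale_block_mx scaler0 add_block_mx addr0.
by rewrite /Gamma_lift -!linearP.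
Qed.
HB.instance Definition _ :=
  GRing.isLinear.Build K (Am1 K m) 'M[K]_(p + q) _ triple_rep triple_rep_is_linear.

Lemma tensor_lift_tens u v : tensor_lift (tens u v) = Lambda_ev A u *m H *m Lambda_ev (- B) v.
Proof.
rewrite /tensor_lift tens_liftE // => x k y y'; first by rewrite linearP !mulmxDl -!scalemxAl.
by rewrite linearP mulmxDr -scalemxAr.
Qed.

Hypothesis hz : hom_triple m z.

Let Am : A ^+ m = 0. Proof. by case: hz. Qed.
Let Bm : (- B) ^+ m = 0.
Proof. by case: hz => _ Bm _; rewrite exprNn Bm mulr0. Qed.

Lemma tensor_lift_lact b t :
  tensor_lift (tensor_lact Lam Lam b t) = Lambda_ev A b *m tensor_lift t.
Proof.
apply: (tens_eq (f := fun t => tensor_lift (tensor_lact Lam Lam b t))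
                (g := fun t => Lambda_ev A b *m tensor_lift t)) t.
- by move=> k s t; rewrite !linearP.
- by move=> k s t; rewrite !linearP.
- by move=> u v; rewrite tensor_lactE !tensor_lift_tens Lambda_evM // !mulmxA.
Qed.

Lemma tensor_lift_ract b t :
  tensor_lift (tensor_ract Lam Lam b t) = tensor_lift t *m Lambda_ev (- B) b.
Proof.
apply: (tens_eq (f := fun t => tensor_lift (tensor_ract Lam Lam b t))
                (g := fun t => tensor_lift t *m Lambda_ev (- B) b)) t.
- by move=> k s t; rewrite !linearP.
- by move=> k s t; rewrite linearP mulmxDl -scalemxAl.
- by move=> u v; rewrite tensor_ractE !tensor_lift_tens Lambda_evM // !mulmxA.
Qed.

Lemma tensor_lift_rel : tensor_lift Gamma_rel = 0.
Proof.
rewrite /Gamma_rel linearD /= !tensor_lift_tens !Lambda_ev1 !Lambda_evX // mulmx1 mul1mx mulmxN.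
by case: hz => _ _ ->; rewrite addNr.
Qed.

(** The relation is sent to A H - H B = 0, and the kernel of [tensor_lift] is stable under both
    actions, so it contains the sub-bimodule generated by the relation. *)
Lemma Gamma_lift_pi t : Gamma_lift (Gamma_pi t) = tensor_lift t.
Proof.
have sub : (gen_bimod (Gamma_rel : T) <= lker (linfun tensor_lift))%VS.
  apply: gen_bimod_ind => b c; rewrite memv_ker lfunE /=; apply/eqP.
  rewrite -[LHS]/(tensor_lift (tensor_lact Lam Lam b (tensor_ract Lam Lam c Gamma_rel))).
  by rewrite tensor_lift_lact tensor_lift_ract tensor_lift_rel mul0mx mulmx0.
have := subvP sub _ (quotv_piK (gen_bimod (Gamma_rel : T)) t).
by rewrite memv_ker lfunE /= linearB subr_eq0 => /eqP.
Qed.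

Lemma Gamma_lift_l b x : Gamma_lift (Gamma_l b x) = Lambda_ev A b *m Gamma_lift x.
Proof. by have [t ->] := Gamma_pi_surj x; rewrite Gamma_l_pi !Gamma_lift_pi tensor_lift_lact. Qed.

Lemma Gamma_lift_r b x : Gamma_lift (Gamma_r b x) = Gamma_lift x *m Lambda_ev (- B) b.
Proof. by have [t ->] := Gamma_pi_surj x; rewrite Gamma_r_pi !Gamma_lift_pi tensor_lift_ract. Qed.

Lemma triple_rep1 : triple_rep 1 = 1%:M.
Proof.
transitivity (block_mx (Lambda_ev A 1) (Gamma_lift 0) 0 (Lambda_ev (- B) 1)); first by [].
by rewrite !Lambda_ev1 /Gamma_lift !linear0 -scalar_mx_block.
Qed.

Lemma triple_repM u v : triple_rep (u * v) = triple_rep u *m triple_rep v.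
Proof.
transitivity (block_mx (Lambda_ev A (u.1.1 * v.1.1))
  (Gamma_lift (Gamma_l u.1.1 v.1.2 + Gamma_r v.2 u.1.2)) 0
  (Lambda_ev (- B) (u.2 * v.2))); first by [].
rewrite /triple_rep mulmx_block !mulmx0 !mul0mx !add0r !addr0 !Lambda_evM //.
rewrite -Gamma_lift_l -Gamma_lift_r; congr block_mx.
by rewrite /Gamma_lift !linearD.
Qed.

End FromTriple.
End AlgebraModules.

(** In a rank factorization e = C R, the equation C R C R = C R can be cancelled on both sides,
    which gives R C = 1. *)
Lemma idempotent_split (K : fieldType) n r (e : 'M[K]_n) : e *m e = e -> \rank e = r ->
  exists (R : 'M[K]_(r, n)) (C : 'M[K]_(n, r)), C *m R = e /\ R *m C = 1%:M.
Proof.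
move=> ee re.
have : exists (R : 'M[K]_(\rank e, n)) (C : 'M[K]_(n, \rank e)),
    [/\ C *m R = e, exists L, L *m C = 1%:M & exists D, R *m D = 1%:M].
  exists (row_base e), (col_base e); split; first exact: mulmx_base.
    exact: row_fullP (col_base_full e).
  exact: row_freeP (row_base_free e).
rewrite re => -[R [C [CR [L LC] [D RD]]]]; exists R, C; split=> //.
transitivity (L *m (e *m e) *m D).
  by rewrite -CR !mulmxA LC mul1mx -!mulmxA RD mulmx1.
by rewrite ee -CR mulmxA LC mul1mx.
Qed.

(** * Every module comes from a triple *)

Section Representations.
Variables (K : closedFieldType) (m : nat).
Hypothesis m0 : (0 < m)%N.

Local Notation Lam := (Lambda K m).
Local Notation LX := (LambdaX K m).
Local Notation Gam := (Gamma K m).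

Definition Am1_elt (b : Lam) (x : Gam) (c : Lam) : Am1 K m := (b, x, c).

Lemma Am1_eltM b x c b' x' c' :
  Am1_elt b x c * Am1_elt b' x' c' = Am1_elt (b * b') (Gamma_l b x' + Gamma_r c' x) (c * c').
Proof. by []. Qed.

Lemma Gamma_lrC b c (x : Gam) : Gamma_l b (Gamma_r c x) = Gamma_r c (Gamma_l b x).
Proof. exact: lractC. Qed.

Lemma Gamma_l0 b : Gamma_l b (0 : Gam) = 0. Proof. exact: linear0. Qed.
Lemma Gamma_r0 b : Gamma_r b (0 : Gam) = 0. Proof. exact: linear0. Qed.
Lemma Gamma_l1 (x : Gam) : Gamma_l 1 x = x. Proof. exact: lact1. Qed.
Lemma Gamma_r1 (x : Gam) : Gamma_r 1 x = x. Proof. exact: ract1. Qed.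
Lemma Gamma_l0l (x : Gam) : Gamma_l 0 x = 0.
Proof. by rewrite /Gamma_l linear0 zero_lfunE. Qed.
Lemma Gamma_r0l (x : Gam) : Gamma_r 0 x = 0.
Proof. by rewrite /Gamma_r linear0 zero_lfunE. Qed.

Lemma Lambda_linear_ev n (A : 'M[K]_n) (phi : Lam -> 'M[K]_n) : linear phi ->
  (forall i, phi (LX ^+ i) = A ^+ i) -> phi =1 Lambda_ev A.
Proof.
move=> lphi phiX b.
pose F : {linear Lam -> 'M[K]_n} := HB.pack phi (GRing.isLinear.Build K _ _ _ phi lphi).
rewrite [in LHS](Lambda_span m0 b) -[LHS]/(F _) linear_sum.
by apply: eq_bigr => i _; rewrite linearZ /= phiX.
Qed.

Definition Am1_eltE := (Am1_eltM, Gamma_l0, Gamma_r0, Gamma_l1, Gamma_r1, Gamma_l0l, Gamma_r0l).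

Section Conjugation.
Variables p q : nat.

Definition conj_rep_fun (G : 'M[K]_(p + q)) (z : triple K p q) (w : Am1 K m) : 'M[K]_(p + q) :=
  invmx G *m triple_rep z w *m G.

Lemma conj_rep_is_linear G z : linear (conj_rep_fun G z).
Proof.
by move=> k w w'; rewrite /conj_rep_fun linearP mulmxDr mulmxDl -scalemxAr -scalemxAl.
Qed.
HB.instance Definition _ G z :=
  GRing.isLinear.Build K (Am1 K m) 'M[K]_(p + q) _ (conj_rep_fun G z) (conj_rep_is_linear G z).

Definition conj_rep G z : 'Hom(Am1 K m, 'M[K]_(p + q)) := linfun (conj_rep_fun G z).

Lemma conj_repE G z w : conj_rep G z w = invmx G *m triple_rep z w *m G.
Proof. by rewrite lfunE. Qed.

Lemma conj_rep_module G z : G \in unitmx -> hom_triple m z ->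
  module_variety (Am1 K m) (p + q) (conj_rep G z).
Proof.
move=> uG hz; split=> [|u v]; rewrite !conj_repE.
  by rewrite (triple_rep1 m0) mulmx1 mulVmx.
by rewrite (triple_repM m0 hz) -!mulmxA (mulmxA G) mulmxV // mul1mx.
Qed.

Lemma tensor_lift_intertwine (A A' : 'M[K]_p) (B B' : 'M[K]_q) (H H' : 'M[K]_(p, q)) g h t :
  A *m g = g *m A' -> B *m h = h *m B' -> H *m h = g *m H' ->
  tensor_lift (m := m) ((A, B, H) : triple K p q) t *m h =
  g *m tensor_lift (m := m) ((A', B', H') : triple K p q) t.
Proof.
move=> Ag Bh Hh.
apply: (tens_eq (f := fun t => tensor_lift ((A, B, H) : triple K p q) t *m h)
  (g := fun t => g *m tensor_lift ((A', B', H') : triple K p q) t)) t.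
- by move=> k s t; rewrite linearP mulmxDl -scalemxAl.
- by move=> k s t; rewrite linearP mulmxDr -scalemxAr.
move=> u v; rewrite !tensor_lift_tens /= /Lambda_ev.
have Bh' : - B *m h = h *m - B' by rewrite mulNmx Bh mulmxN.
rewrite -!mulmxA (trunc_ev_intertwine m (Lambda_val v) Bh') (mulmxA H) Hh.
by rewrite -(mulmxA g) (mulmxA _ g) (trunc_ev_intertwine m (Lambda_val u) Ag) -mulmxA.
Qed.

(** An isomorphism (g, h) of triples can be absorbed into the conjugating matrix. This brings two
    generic triples over the same pair (A, B). *)
Lemma conj_rep_sim (A A' : 'M[K]_p) (B B' : 'M[K]_q) (H H' : 'M[K]_(p, q)) g h G :
  g \in unitmx -> h \in unitmx -> G \in unitmx ->
  A *m g = g *m A' -> B *m h = h *m B' -> H *m h = g *m H' ->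
  conj_rep G ((A', B', H') : triple K p q) =
  conj_rep (block_mx g 0 0 h *m G) ((A, B, H) : triple K p q).
Proof.
move=> ug uh uG Ag Bh Hh; set D := block_mx g 0 0 h.
have uD : D \in unitmx by rewrite unitmxE det_ublock unitrM -!unitmxE ug.
apply/lfunP => w; rewrite !conj_repE.
have FD : triple_rep ((A, B, H) : triple K p q) w *m D =
    D *m triple_rep ((A', B', H') : triple K p q) w.
  rewrite /triple_rep /D !mulmx_block !mulmx0 !mul0mx !add0r !addr0 /Gamma_lift.
  rewrite (tensor_lift_intertwine _ Ag Bh Hh) /Lambda_ev (trunc_ev_intertwine m _ Ag).
  have Bh' : - B *m h = h *m - B' by rewrite mulNmx Bh mulmxN.
  by rewrite (trunc_ev_intertwine m _ Bh').
have uDG : D *m G \in unitmx by rewrite unitmx_mul uD.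
rewrite -[LHS](mulKmx uDG) -[in RHS]mulmxA; congr (_ *m _).
rewrite [in RHS]mulmxA FD -!mulmxA; congr (D *m _).
by rewrite !mulmxA mulmxV // mul1mx.
Qed.

(** Peirce decomposition: the orthogonal idempotents f(1,0,0) and f(0,0,1) sum to 1. In an adapted
    basis [f] is block upper triangular, and its blocks are determined by the values at the two
    copies of X and at the generator of [Gamma]. *)
Lemma conj_rep_surj (f : 'Hom(Am1 K m, 'M[K]_(p + q))) :
  module_variety (Am1 K m) (p + q) f -> \rank (f (Am1_elt 1 0 0)) = p ->
  exists (G : 'M[K]_(p + q)) (z : triple K p q),
    [/\ G \in unitmx, hom_triple m z & f = conj_rep G z].
Proof.
move=> [f1 fM] rk; set e1 := f (Am1_elt 1 0 0) in rk; pose e2 := f (Am1_elt 0 0 1).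
have e11 : e1 *m e1 = e1 by rewrite -fM !Am1_eltE mulr0 mulr1 addr0.
have e22 : e2 *m e2 = e2 by rewrite -fM !Am1_eltE mulr0 mulr1 addr0.
have e12 : e1 *m e2 = 0.
  by rewrite -fM !Am1_eltE mulr0 mul0r addr0 -[RHS](linear0 f).
have e21 : e2 *m e1 = 0.
  by rewrite -fM !Am1_eltE mulr0 mul0r addr0 -[RHS](linear0 f).
have e1D2 : e1 + e2 = 1%:M.
  rewrite -f1 /e1 /e2 -linearD; congr (f _); congr (_, _, _) => /=.
  - by rewrite addr0.
  - by rewrite addr0.
  - by rewrite add0r.
have [R1 [C1 [CR1 RC1]]] := idempotent_split e11 rk.
have Re (r : nat) (e : 'M[K]_(p + q)) (R : 'M_(r, p + q)) (C : 'M_(p + q, r)) :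
    C *m R = e -> R *m C = 1%:M -> R *m e = R /\ e *m C = C.
  by move=> <- RC; rewrite mulmxA RC mul1mx -mulmxA RC mulmx1.
have [R1e C1e] := Re _ _ _ _ CR1 RC1.
have split_mx r (R2 : 'M[K]_(r, p + q)) (C2 : 'M[K]_(p + q, r)) :
    C2 *m R2 = e2 -> R2 *m C2 = 1%:M ->
    col_mx R1 R2 *m row_mx C1 C2 = 1%:M /\ row_mx C1 C2 *m col_mx R1 R2 = 1%:M.
  move=> CR2 RC2; have [R2e C2e] := Re _ _ _ _ CR2 RC2.
  rewrite mul_col_row mul_row_col CR1 CR2 e1D2 RC1 RC2 -R1e -C2e; split=> //.
  rewrite -!mulmxA (mulmxA e1) e12 mul0mx mulmx0 -R2e -C1e -!mulmxA (mulmxA e2) e21.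
  by rewrite mul0mx mulmx0 -scalar_mx_block.
(* A first splitting of [e2] gives mutually inverse matrices between dimensions p + rank e2 and p +
   q; once the rank is known, a second splitting has the required sizes. *)
have rk2 : \rank e2 = q.
  have [R2 [C2 [CR2 RC2]]] := idempotent_split e22 (erefl _).
  have [/mulmx1_min le1 /mulmx1_min le2] := split_mx _ _ _ CR2 RC2.
  by apply/eqP; rewrite -(eqn_add2l p) eqn_leq le1 le2.
have [R2 [C2 [CR2 RC2]]] := idempotent_split e22 rk2.
have [R2e C2e] := Re _ _ _ _ CR2 RC2; have [GG' G'G] := split_mx _ _ _ CR2 RC2.
pose A := R1 *m f (Am1_elt LX 0 0) *m C1.
pose B := - (R2 *m f (Am1_elt 0 0 LX) *m C2).
pose H := R1 *m f (Am1_elt 0 (Gamma_gen K m) 0) *m C2.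
have corner11 b x c : R1 *m f (Am1_elt b x c) *m C1 = R1 *m f (Am1_elt b 0 0) *m C1.
  rewrite -{1}R1e -{1}C1e -!mulmxA (mulmxA (f (Am1_elt b x c))) -fM (mulmxA e1) -fM !Am1_eltE.
  by rewrite !mul1r !mulr1 ?mulr0 ?mul0r ?(add0r, addr0) mulmxA.
have corner12 b x c : R1 *m f (Am1_elt b x c) *m C2 = R1 *m f (Am1_elt 0 x 0) *m C2.
  rewrite -{1}R1e -{1}C2e -!mulmxA (mulmxA (f (Am1_elt b x c))) -fM (mulmxA e1) -fM !Am1_eltE.
  by rewrite !(mul1r, mulr1, mulr0, mul0r, add0r, addr0) mulmxA.
have corner21 w : R2 *m f w *m C1 = 0.
  case: w => [[b x] c]; rewrite -[(b, x, c)]/(Am1_elt b x c).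
  rewrite -{1}R2e -{1}C1e -!mulmxA (mulmxA (f (Am1_elt b x c))) -fM (mulmxA e2) -fM !Am1_eltE.
  rewrite !(mul1r, mulr1, mulr0, mul0r, add0r, addr0).
  by rewrite -[Am1_elt 0 0 0]/(0 : Am1 K m) linear0 mul0mx mulmx0.
have corner22 b x c : R2 *m f (Am1_elt b x c) *m C2 = R2 *m f (Am1_elt 0 0 c) *m C2.
  rewrite -{1}R2e -{1}C2e -!mulmxA (mulmxA (f (Am1_elt b x c))) -fM (mulmxA e2) -fM !Am1_eltE.
  by rewrite !(mul1r, mulr1, mulr0, mul0r, add0r, addr0) mulmxA.
have f11M b b' : R1 *m f (Am1_elt (b * b') 0 0) *m C1 =
    (R1 *m f (Am1_elt b 0 0) *m C1) *m (R1 *m f (Am1_elt b' 0 0) *m C1).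
  rewrite -!mulmxA (mulmxA C1) CR1 (mulmxA e1) -fM !Am1_eltE mul1r mul0r addr0.
  by rewrite (mulmxA (f _)) -fM !Am1_eltE mulr0 addr0.
have f22M b b' : R2 *m f (Am1_elt 0 0 (b * b')) *m C2 =
    (R2 *m f (Am1_elt 0 0 b) *m C2) *m (R2 *m f (Am1_elt 0 0 b') *m C2).
  rewrite -!mulmxA (mulmxA C2) CR2 (mulmxA e2) -fM !Am1_eltE mul1r mul0r addr0.
  by rewrite (mulmxA (f _)) -fM !Am1_eltE mulr0 addr0.
have f11X i : R1 *m f (Am1_elt (LX ^+ i) 0 0) *m C1 = A ^+ i.
  elim: i => [|i IHi]; last by rewrite exprS f11M IHi -mxpowS.
  by rewrite !expr0 R1e RC1.
have f22X i : R2 *m f (Am1_elt 0 0 (LX ^+ i)) *m C2 = (- B) ^+ i.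
  elim: i => [|i IHi]; last by rewrite exprS f22M IHi opprK -mxpowS.
  by rewrite !expr0 R2e RC2.
have f11E b : R1 *m f (Am1_elt b 0 0) *m C1 = Lambda_ev A b.
  apply: (Lambda_linear_ev (phi := fun b => R1 *m f (Am1_elt b 0 0) *m C1)) => // k u v.
  rewrite scalemxAl scalemxAr -linearZ -mulmxDl -mulmxDr -linearD.
  by congr (_ *m f _ *m _); congr (_, _, _); rewrite /= ?scaler0 ?addr0.
have f22E b : R2 *m f (Am1_elt 0 0 b) *m C2 = Lambda_ev (- B) b.
  apply: (Lambda_linear_ev (phi := fun b => R2 *m f (Am1_elt 0 0 b) *m C2)) => // k u v.
  rewrite scalemxAl scalemxAr -linearZ -mulmxDl -mulmxDr -linearD.
  by congr (_ *m f _ *m _); congr (_, _, _); rewrite /= ?scaler0 ?addr0.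
have am0 : Am1_elt 0 0 0 = 0 by [].
have f12M u v x : R1 *m f (Am1_elt 0 (Gamma_l u (Gamma_r v x)) 0) *m C2 =
    Lambda_ev A u *m (R1 *m f (Am1_elt 0 x 0) *m C2) *m Lambda_ev (- B) v.
  transitivity (R1 *m (f (Am1_elt u 0 0) *m e1 *m f (Am1_elt 0 x 0) *m e2 *m
    f (Am1_elt 0 0 v)) *m C2).
    by rewrite -!fM !Am1_eltE !(mul1r, mulr1, mulr0, mul0r, add0r, addr0) Gamma_lrC.
  by rewrite -f11E -f22E -CR1 -CR2 !mulmxA.
have hz : hom_triple m ((A, B, H) : triple K p q).
  split=> /=.
  - by rewrite -f11X Lambda_nilpotent // am0 linear0 mulmx0 mul0mx.
  - rewrite -[B]opprK exprNn -f22X Lambda_nilpotent // am0 linear0 mulmx0 mul0mx.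
    by rewrite mulr0.
  - have evA : Lambda_ev A LX = A by rewrite -f11E.
    have evB : Lambda_ev (- B) LX = - B by rewrite -f22E opprK.
    (* In [Gamma] the generator anticommutes with X; applying [f] gives A H = - H (- B). *)
    have := f12M LX 1 (Gamma_gen K m); have := f12M 1 LX (Gamma_gen K m).
    rewrite Gamma_r1 Gamma_l1 Gamma_gen_anticomm !Lambda_ev1 // !mul1mx !mulmx1 evA evB => e1' e2'.
    have amN : Am1_elt 0 (- Gamma_r LX (Gamma_gen K m)) 0 =
        - Am1_elt 0 (Gamma_r LX (Gamma_gen K m)) 0.
      by congr (_, _, _); rewrite /= oppr0.
    by rewrite -[LHS]e2' amN linearN /= mulmxN mulNmx e1' mulmxN opprK.
exists (col_mx R1 R2), (A, B, H); split=> //.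
  by case/mulmx1_unit: GG'.
apply/lfunP => w; rewrite conj_repE.
have -> : invmx (col_mx R1 R2) = row_mx C1 C2.
  by rewrite -[LHS]mul1mx -G'G mulmxK //; case/mulmx1_unit: GG'.
have FE : triple_rep ((A, B, H) : triple K p q) w = col_mx R1 R2 *m f w *m row_mx C1 C2.
  case: w => [[b x] c]; rewrite -[(b, x, c)]/(Am1_elt b x c).
  rewrite mul_col_mx mul_col_row corner11 corner12 corner21 corner22 f11E f22E.
  congr block_mx.
  have [t ->] := Gamma_pi_surj x; rewrite (Gamma_lift_pi m0 hz).
  apply: (tens_eq (g := fun t => R1 *m f (Am1_elt 0 (Gamma_pi t) 0) *m C2)).
  - exact: tensor_lift_is_linear.
  - move=> k t1 t2; rewrite scalemxAl scalemxAr -linearZ -mulmxDl -mulmxDr -linearD.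
    congr (_ *m f _ *m _).
    by congr (_, _, _); rewrite /= ?scaler0 ?addr0 // /Gamma_pi linearP.
  - by move=> u v; rewrite tensor_lift_tens Gamma_pi_tens f12M.
by rewrite FE !mulmxA G'G mul1mx -mulmxA G'G mulmx1.
Qed.

End Conjugation.
End Representations.

(** * The Zariski topology *)

Section ZariskiClosed.
Variables (K : fieldType) (V : vectType K).

Lemma zariski_closedP (F : set (zariski V)) :
  closed F <-> exists S, F = zero_locus S.
Proof.
rewrite -openC; split=> [[S /(congr1 setC)]|[S ->]]; last by exists S.
by rewrite !setCK => ->; exists S.
Qed.

Definition polynomial_fun (f : V -> K) := exists P, forall v, f v = meval (coords v) P.

Lemma polynomial_fun_const c : polynomial_fun (fun=> c).
Proof. by exists (mpolyC _ c) => v; rewrite mevalC. Qed.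

Lemma polynomial_funD f g : polynomial_fun f -> polynomial_fun g ->
  polynomial_fun (fun v => f v + g v).
Proof. by move=> [P fP] [Q gQ]; exists (P + Q) => v; rewrite mevalD fP gQ. Qed.

Lemma polynomial_funM f g : polynomial_fun f -> polynomial_fun g ->
  polynomial_fun (fun v => f v * g v).
Proof. by move=> [P fP] [Q gQ]; exists (P * Q) => v; rewrite mevalM fP gQ. Qed.

Lemma polynomial_fun_eq f g : f =1 g -> polynomial_fun f -> polynomial_fun g.
Proof. by move=> fg [P fP]; exists P => v; rewrite -fg. Qed.

Lemma polynomial_fun_sum (I : Type) (s : seq I) (Q : pred I) (F : I -> V -> K) :
  (forall i, polynomial_fun (F i)) -> polynomial_fun (fun v => \sum_(i <- s | Q i) F i v).
Proof.
move=> Fr; elim: s => [|i s IHs].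
  by apply: polynomial_fun_eq (polynomial_fun_const 0) => v; rewrite big_nil.
case Qi: (Q i); last by apply: polynomial_fun_eq IHs => v; rewrite big_cons Qi.
by apply: polynomial_fun_eq (polynomial_funD (Fr i) IHs) => v; rewrite big_cons Qi.
Qed.

Lemma polynomial_fun_prod (I : Type) (s : seq I) (Q : pred I) (F : I -> V -> K) :
  (forall i, polynomial_fun (F i)) -> polynomial_fun (fun v => \prod_(i <- s | Q i) F i v).
Proof.
move=> Fr; elim: s => [|i s IHs].
  by apply: polynomial_fun_eq (polynomial_fun_const 1) => v; rewrite big_nil.
case Qi: (Q i); last by apply: polynomial_fun_eq IHs => v; rewrite big_cons Qi.
by apply: polynomial_fun_eq (polynomial_funM (Fr i) IHs) => v; rewrite big_cons Qi.
Qed.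

Lemma polynomial_fun_linear (f : V -> K^o) : linear f -> polynomial_fun f.
Proof.
move=> lf; pose F : {linear V -> K^o} := HB.pack f (GRing.isLinear.Build K _ _ _ f lf).
apply: (@polynomial_fun_eq (fun v => \sum_i coords v i * F (vbasis {:V})`_i)).
  move=> v; rewrite -[RHS]/(F v) [in RHS](coord_vbasis (memvf v)) linear_sum.
  by apply: eq_bigr => i _; rewrite linearZ.
apply: polynomial_fun_sum => i; apply: polynomial_funM (polynomial_fun_const _).
by exists (mpolyX _ (mnm1 i)) => v; rewrite mevalXU.
Qed.

Lemma polynomial_fun_det n (X : V -> 'M[K]_n) :
  (forall i j, polynomial_fun (fun v => X v i j)) -> polynomial_fun (fun v => \det (X v)).
Proof.
move=> pX; apply: polynomial_fun_sum => s; apply: polynomial_funM.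
  exact: polynomial_fun_const.
by apply: polynomial_fun_prod.
Qed.

Lemma polynomial_fun_closed (I : Type) (f : I -> V -> K) :
  (forall i, polynomial_fun (f i)) ->
  closed ([set v | forall i, f i v = 0]%classic : set (zariski V)).
Proof.
move=> /choice[P fP]; apply/zariski_closedP; exists (range P).
rewrite eqEsubset; split=> v /= f0.
  by move=> _ [i _ <-]; rewrite -fP.
by move=> i; rewrite fP; apply: f0; exists i.
Qed.

End ZariskiClosed.

(** A relatively clopen part, cut out by [C] closed and [O] open, leaves [A] covered by [C] and the
    complement of [O]; the latter cannot contain [A] if the part is nonempty. *)
Lemma irreducible_connected (T : topologicalType) (A : set T) :
  irreducible_set A -> connected A.
Proof.
move=> [_ irr] B [b Bb] [O oO BO] [C cC BC]; apply/seteqP; split.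
  by rewrite BC; apply: subIset; left.
have /(irr C (~` O)%classic cC (open_closedC oO))[AC|AO] : (A `<=` C `|` ~` O)%classic.
- move=> x Ax; have [Ox|nOx] := pselect (O x); last by right.
  by left; have : B x by [rewrite BO]; rewrite BC => -[].
- by move=> x Ax; rewrite BC; split=> //; apply: AC.
by move: Bb; rewrite BO => -[Ab Ob]; case: (AO b Ab).
Qed.

Section RationalCurvesInHom.
Variables (K : closedFieldType) (U : vectType K) (n : nat).

Definition elem_hom (k : 'I_(\dim {:U})) (x y : 'I_n) (u : U) : 'M[K]_n :=
  coord (vbasis {:U}) k u *: delta_mx x y.

Lemma elem_hom_is_linear k x y : linear (elem_hom k x y).
Proof. by move=> a u v; rewrite /elem_hom linearP scalerDl scalerA. Qed.
HB.instance Definition _ k x y :=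
  GRing.isLinear.Build K U 'M[K]_n _ (elem_hom k x y) (elem_hom_is_linear k x y).

(** The coordinates refer to an unspecified basis of the space of homomorphisms. Each is a linear
    form, so expanding in the [elem_hom] writes it as a fixed combination of entries of the images
    of a basis of [U]. *)
Lemma ratfun_meval d (phi : K -> 'Hom(U, 'M[K]_n)) P :
  (forall u, ratmx d (fun t => phi t u)) ->
  ratfun d (fun t => meval (coords (phi t)) P).
Proof.
move=> rphi.
have rlin (f : {linear 'Hom(U, 'M[K]_n) -> K^o}) : ratfun d (fun t => f (phi t)).
  pose b := vbasis {:U}.
  pose E (k : 'I_(\dim {:U})) (x y : 'I_n) : 'Hom(U, 'M[K]_n) := linfun (elem_hom k x y).
  have fE t : \sum_(k < \dim {:U}) \sum_(x < n) \sum_(y < n)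
      phi t b`_k x y * (f (E k x y) : K) = f (phi t).
    rewrite [in RHS](_ : phi t = \sum_(k < \dim {:U}) \sum_(x < n) \sum_(y < n)
        phi t b`_k x y *: E k x y).
      rewrite linear_sum; apply: eq_bigr => k _; rewrite linear_sum; apply: eq_bigr => x _.
      by rewrite linear_sum; apply: eq_bigr => y _; rewrite linearZ.
    apply/lfunP => u; rewrite [in LHS](coord_vbasis (memvf u)) linear_sum sum_lfunE.
    apply: eq_bigr => k _; rewrite linearZ /= [X in _ *: X = _]matrix_sum_delta.
    rewrite sum_lfunE scaler_sumr; apply: eq_bigr => x _.
    rewrite sum_lfunE scaler_sumr; apply: eq_bigr => y _.
    by rewrite scale_lfunE lfunE /= /elem_hom !scalerA mulrC.
  apply: (@ratfun_eq K d _ _ (fun t _ => fE t)).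
  apply: ratfun_sum => k; apply: ratfun_sum => x; apply: ratfun_sum => y.
  by apply: ratfunM; [apply: rphi|apply: ratfun_const].
apply: (@ratfun_eq _ _ (fun t => \sum_(a <- msupp P) mcoeff a P * \prod_i coords (phi t) i ^+ a i)).
  by move=> t _; rewrite mevalE.
apply: ratfun_sum => a; apply: ratfunM (ratfun_const _ _) _; apply: ratfun_prod => i.
by apply: ratfunX; apply: rlin.
Qed.

End RationalCurvesInHom.

(** * Irreducibility of the rank strata *)

Section Components.
Variables (K : closedFieldType) (m : nat).
Hypothesis m0 : (0 < m)%N.

Definition rank_stratum d r : set (zariski 'Hom(Am1 K m, 'M[K]_d)) :=
  [set f | module_variety (Am1 K m) d f /\
    \rank ((f : 'Hom(Am1 K m, 'M[K]_d)) (Am1_elt 1 0 0)) = r]%classic.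

Lemma ratmx_tensor_lift p q d (A A' : 'M[K]_p) (B B' : 'M[K]_q) (H H' : 'M[K]_(p, q)) t0 :
  ratmx d (fun t =>
    tensor_lift (m := m) ((A + t *: A', B + t *: B', H + t *: H') : triple K p q) t0).
Proof.
apply: ratmx_sum => i; apply: ratmx_sum => j; apply: ratmxZ (ratfun_const _ _) _.
apply: ratmxM; first apply: ratmxM (ratmx_line _ _ _).
  by apply: ratmx_sum => k; apply: ratmxZ (ratfun_const _ _) (ratmxX _ (ratmx_line _ _ _)).
apply: ratmx_sum => k; apply: ratmxZ (ratfun_const _ _) (ratmxX _ _).
apply: (@ratmx_eq K d _ _ (fun t => - B + t *: - B')) (ratmx_line _ _ _) => t _.
by rewrite scalerN opprD.
Qed.

Lemma ratmx_triple_rep p q d (z z' : triple K p q) (w : Am1 K m) :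
  ratmx d (fun t => triple_rep (z + t *: z') w).
Proof.
case: z z' => [[A B] H] [[A' B'] H'].
apply: ratmx_block; [| | exact: ratmx_const |].
- by apply: ratmx_sum => k; apply: ratmxZ (ratfun_const _ _) (ratmxX _ (ratmx_line _ _ _)).
- exact: ratmx_tensor_lift.
- apply: ratmx_sum => k; apply: ratmxZ (ratfun_const _ _) (ratmxX _ _).
  apply: (@ratmx_eq K d _ _ (fun t => - B + t *: - B')) (ratmx_line _ _ _) => t _.
  by rewrite /= scalerN opprD.
Qed.

Lemma triple_rep_idempotent p q (z : triple K p q) :
  triple_rep z (Am1_elt 1 0 0 : Am1 K m) = block_mx 1%:M 0 0 0.
Proof.
transitivity (block_mx (Lambda_ev z.1.1 (1 : Lambda K m)) (Gamma_lift z (0 : Gamma K m)) 0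
  (Lambda_ev (- z.1.2) (0 : Lambda K m))); first by [].
by rewrite (Lambda_ev1 m0) /Gamma_lift !linear0.
Qed.

Lemma conj_rep_stratum p q (G : 'M[K]_(p + q)) (z : triple K p q) :
  G \in unitmx -> hom_triple m z -> rank_stratum p (conj_rep m G z).
Proof.
move=> uG hz; split; first exact: conj_rep_module.
rewrite conj_repE mxrankMfree ?row_free_unit // eqmxMfull ?row_full_unit ?unitmx_inv //.
rewrite triple_rep_idempotent.
by rewrite rank_diag_block_mx mxrank1 mxrank0 addn0.
Qed.

(** If neither closed set contained the stratum, some equations [P] and [Q] would each be nonzero
    somewhere on it, but never at the same point. A rational curve in the stratum joining a point
    where [P] is nonzero to one where [Q] is nonzero contradicts this. *)
Lemma stratum_irreducible p q f :
  @rank_stratum (p + q) p f -> irreducible_set (@rank_stratum (p + q) p).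
Proof.
move=> sf; split; first by exists f.
move=> _ _ /zariski_closedP[S1 ->] /zariski_closedP[S2 ->] sub.
have [|/existsNP[f1 /not_implyP[sf1 /existsNP[P /not_implyP[SP Pf1]]]]] :=
  pselect (@rank_stratum (p + q) p `<=` zero_locus S1)%classic; first by left.
have [|/existsNP[f2 /not_implyP[sf2 /existsNP[Q /not_implyP[SQ Qf2]]]]] :=
  pselect (@rank_stratum (p + q) p `<=` zero_locus S2)%classic; first by right.
exfalso.
have PQ g : rank_stratum p g -> meval (coords g) P = 0 \/ meval (coords g) Q = 0.
  by move=> /sub[/(_ _ SP)|/(_ _ SQ)]; [left|right].
(* For fixed [G] the polynomial is a function of the triple that is polynomial along lines, so by
   density it is nonzero at some generic triple. *)
have gen g R : @rank_stratum (p + q) p g -> meval (coords g) R <> 0 ->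
    exists (G : 'M[K]_(p + q)) (z : triple K p q),
    [/\ G \in unitmx, generic_triple m z &
      meval (coords (conj_rep m G z : 'Hom(Am1 K m, 'M[K]_(p + q)))) R != 0].
  move=> [mg rg] Rg; have [G [z [uG hz gE]]] := conj_rep_surj m0 mg rg.
  have [//|nex] := pselect (exists (G : 'M[K]_(p + q)) (z : triple K p q),
    [/\ G \in unitmx, generic_triple m z &
      meval (coords (conj_rep m G z : 'Hom(Am1 K m, 'M[K]_(p + q)))) R != 0]).
  case: Rg; rewrite gE.
  apply: (generic_triple_dense m0 hz (P := fun z => meval (coords (conj_rep m G z)) R)).
    move=> x w; apply: ratfun_meval => u.
    apply: (@ratmx_eq K _ _ _ (fun t => invmx G *m triple_rep (x + t *: w) u *m G)).
      by move=> t _; rewrite conj_repE.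
    apply: ratmxM (ratmx_const _ _); apply: ratmxM; first exact: ratmx_const.
    exact: ratmx_triple_rep.
  move=> s gs; apply/eqP; apply/negPn/negP => ns; apply: nex.
  by exists G, s.
have [G1 [[[A1 B1] H1] [uG1 [/= h1 gA1 gB1] nP]]] := gen _ _ sf1 Pf1.
have [G2 [[[A2 B2] H2] [uG2 [/= h2 gA2 gB2] nQ]]] := gen _ _ sf2 Qf2.
(* Generic matrices of one size are conjugate, so the second triple can be transported over the pair
   (A1, B1) of the first. *)
have [g [ug Ag]] := generic_sim gA1 gA2.
have [h [uh Bh]] := generic_sim gB1 gB2.
have [H2' Hh] : exists H2', H2' *m h = g *m H2.
  by exists (g *m H2 *m invmx h); rewrite mulmxKV.
rewrite (conj_rep_sim m ug uh uG2 Ag Bh Hh) in nQ.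
set G2' := _ *m G2 in nQ.
have uG2' : G2' \in unitmx.
  by rewrite unitmx_mul uG2 andbT unitmxE det_ublock unitrM -!unitmxE ug.
have [_ _ /= AH1] := h1; have [Am2 Bm2 /= AH2] := h2.
have AH2' : A1 *m H2' = H2' *m B1.
  apply: (can_inj (mulmxK uh)); rewrite -!mulmxA Hh Bh !mulmxA Ag Hh.
  by rewrite -!mulmxA AH2.
(* Over the fixed pair (A1, B1) the homomorphisms form a vector space, so a line joins the two
   triples and another the two conjugating matrices. [G t] is singular only at the roots of its
   determinant [d], which is nonzero at 0 and 1. *)
pose G t := G1 + t *: (G2' - G1).
pose z t : triple K p q := (A1, B1, H1) + t *: (0, 0, H2' - H1).
have zE t : z t = (A1, B1, H1 + t *: (H2' - H1)).
  by congr (_, _, _); rewrite /= scaler0 addr0.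
have hz t : hom_triple m (z t).
  have [? ? _] := h1; rewrite zE; split=> //=.
  by rewrite mulmxDr mulmxDl -scalemxAr -scalemxAl mulmxBr mulmxBl AH1 AH2'.
have [N [d dE]] := ratfun_det (ratmx_line 1 G1 (G2' - G1)).
have {}dE t : \det (G t) = d.[t].
  by rewrite -dE hornerC ?oner_eq0 // expr1n mulr1.
have rpsi R : ratfun d (fun t => meval (coords (conj_rep m (G t) (z t))) R).
  apply: ratfun_meval => u.
  apply: (@ratmx_eq K _ _ _ (fun t => invmx (G t) *m triple_rep (z t) u *m G t)).
    by move=> t _; rewrite conj_repE.
  apply: ratmxM; last exact: ratmx_line; apply: ratmxM; last exact: ratmx_triple_rep.
  exact: ratmx_inv (ratmx_line _ _ _) dE.
have G0 : G 0 = G1 by rewrite /G scale0r addr0.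
have G1' : G 1 = G2' by rewrite /G scale1r addrC subrK.
have z0 : z 0 = (A1, B1, H1) by rewrite zE scale0r addr0.
have z1 : z 1 = (A1, B1, H2') by rewrite zE scale1r addrC subrK.
have d0 : d.[0] != 0 by rewrite -dE G0 -unitfE -unitmxE.
have d1 : d.[1] != 0 by rewrite -dE G1' -unitfE -unitmxE.
rewrite -G0 -z0 in nP; rewrite -G1' -z1 in nQ.
have [t [[Pt dt] [Qt _]]] := almost_ex (almost_and
  (ratfun_almost (rpsi P) d0 nP) (ratfun_almost (rpsi Q) d1 nQ)).
have uGt : G t \in unitmx by rewrite unitmxE dE unitfE.
by have [/eqP|/eqP] := PQ _ (conj_rep_stratum uGt (hz t)); apply/negP.
Qed.

End Components.

(** * Connected components of the module variety *)

Section Main.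
Variables (K : closedFieldType) (m : nat).
Hypothesis m0 : (0 < m)%N.

Local Open Scope classical_set_scope.

(* det (s e + 1 - e) = s ^ r for an idempotent e of rank r; the trace of e would
   only give r modulo the characteristic. *)
Definition det_locus d r : set (zariski 'Hom(Am1 K m, 'M[K]_d)) :=
  [set f | forall s : K, \det (s *: (f : 'Hom(Am1 K m, 'M[K]_d)) (Am1_elt 1 0 0) +
    (1%:M - (f : 'Hom(Am1 K m, 'M[K]_d)) (Am1_elt 1 0 0))) - s ^+ r = 0].

Lemma polynomial_fun_hom_entry d (u : Am1 K m) (i j : 'I_d) :
  polynomial_fun (fun f : 'Hom(Am1 K m, 'M[K]_d) => f u i j).
Proof. by apply: polynomial_fun_linear => k f g; rewrite add_lfunE scale_lfunE !mxE. Qed.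

Lemma det_locus_closed d r : closed (@det_locus d r).
Proof.
apply: (@polynomial_fun_closed _ _ K (fun s (f : 'Hom(Am1 K m, 'M[K]_d)) =>
  \det (s *: f (Am1_elt 1 0 0) + (1%:M - f (Am1_elt 1 0 0))) + - s ^+ r)) => s.
apply: polynomial_funD _ (polynomial_fun_const _ _); apply: polynomial_fun_det => i j.
apply: (@polynomial_fun_eq _ _ (fun f : 'Hom(Am1 K m, 'M[K]_d) =>
  (1%:M : 'M[K]_d) i j + (s - 1) * f (Am1_elt 1 0 0) i j)).
  by move=> f; rewrite !mxE; ring.
by apply: polynomial_funD (polynomial_fun_const _ _)
  (polynomial_funM (polynomial_fun_const _ _) (polynomial_fun_hom_entry _ _ _)).
Qed.

Lemma rank_det d r f : @rank_stratum K m d r f -> det_locus r f.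
Proof.
move=> [mf rf]; have /subnKC : (r <= d)%N by rewrite -rf rank_leq_row.
move: (d - r)%N => q dq; subst d => s; have [G [z [uG hz ->]]] := conj_rep_surj m0 mf rf.
rewrite conj_repE triple_rep_idempotent //.
apply/eqP; rewrite subr_eq0; apply/eqP.
transitivity (\det (invmx G *m block_mx s%:M 0 0 1%:M *m G)).
  congr (\det _); rewrite -[X in X - _](mulVmx uG) -[invmx G in X in _ + (X - _)]mulmx1.
  rewrite scalemxAl scalemxAr -mulmxBl -mulmxBr -mulmxDl -mulmxDr; congr (_ *m _ *m _).
  rewrite scalar_mx_block scale_block_mx opp_block_mx !add_block_mx.
  by rewrite !scaler0 !oppr0 !addr0 subrr addr0 add0r scalemx1.
rewrite !det_mulmx det_inv mulrAC mulVf ?mul1r -?unitfE -?unitmxE //.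
by rewrite det_ublock det_scalar det1 mulr1.
Qed.

Lemma rank_stratum_irreducible d r f :
  @rank_stratum K m d r f -> irreducible_set (@rank_stratum K m d r).
Proof.
move=> sf; have /subnKC : (r <= d)%N by rewrite -(proj2 sf) rank_leq_row.
by move: (d - r)%N => q dq; subst d; apply: stratum_irreducible sf.
Qed.

(** Distinct powers of s are distinct functions on an infinite field. *)
Lemma det_locus_inj d r r' f : @det_locus d r f -> det_locus r' f -> r = r'.
Proof.
move=> fr fr'; have [//|nr] := eqVneq r r'.
have : ('X^r - 'X^r' : {poly K}) != 0.
  rewrite subr_eq0; apply: contraNneq nr => /(congr1 (size \o polyseq)) /=.
  by rewrite !size_polyXn => -[->].
move=> /poly_nonroot[t]; rewrite !hornerE subr_eq0 => /eqP[].
by rewrite -(subr0_eq (fr t)); apply: subr0_eq (fr' t).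
Qed.

(** A stratum is irreducible, hence connected, and so lies in the component. Conversely the strata
    are finitely many and cut out by closed loci, so each is relatively open and closed. *)
Lemma component_stratum d f : module_variety (Am1 K m) d f ->
  connected_component (module_variety (Am1 K m) d) f =
  rank_stratum (\rank ((f : 'Hom(Am1 K m, 'M[K]_d)) (Am1_elt 1 0 0))).
Proof.
move=> mf; set r := \rank _; set CC := connected_component _ _.
have sf : rank_stratum r f by [].
apply/seteqP; split; last first.
  apply: connected_component_max => // [g [] //|].
  exact: irreducible_connected (rank_stratum_irreducible sf).
have CCm g : CC g -> module_variety (Am1 K m) d g.
  exact: connected_component_sub.
have det_rank g : module_variety (Am1 K m) d g ->
  det_locus (\rank ((g : 'Hom(Am1 K m, 'M[K]_d)) (Am1_elt 1 0 0))) g.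
  by move=> mg; apply: rank_det.
have stratumE g : CC g -> rank_stratum r g <-> det_locus r g.
  move=> /CCm mg; split; first exact: rank_det.
  by move=> detg; split=> //; apply: det_locus_inj (det_rank _ mg) detg.
suff <- : CC `&` rank_stratum r = CC by move=> g [].
apply: component_connected.
- by exists f; split=> //; apply: connected_component_refl.
(* The rank takes only the values 0, ..., d, so inside the component the stratum is the complement
   of finitely many closed loci. *)
- exists (~` \bigcup_(i in `I_d.+1 `\ r) det_locus i).
    apply: closed_openC; apply: closed_bigcup => [|i _]; last exact: det_locus_closed.
    by apply: finite_setD; apply: finite_II.
  apply/seteqP; split=> g [CCg b]; split=> //.
    move: b => /(proj1 (stratumE _ CCg)) Gamma_r [i [_ /= ir] gi].
    by apply: ir; apply: det_locus_inj gi Gamma_r.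
  move: b; apply: contra_notP => nsg; exists (\rank ((g : 'Hom(Am1 K m, 'M[K]_d)) (Am1_elt 1 0 0))).
    split=> /=; first by rewrite ltnS rank_leq_row.
    by move=> rg; apply: nsg; split=> //; apply: CCm.
  by apply: det_rank; apply: CCm.
- exists (det_locus r); first exact: det_locus_closed.
  by apply/seteqP; split=> g [CCg b]; split=> //; apply/(stratumE _ CCg).
Qed.

End Main.

Theorem corollary1p2 (K : closedFieldType) (m : nat) (hm : (1 <= m)%N) :
  geometrically_irreducible (Am1 K m).
Proof.
move=> d f mf; rewrite component_stratum //.
exact: (rank_stratum_irreducible hm (f := f)).
Qed.
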